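(* Let $M\in S\mathcal{O}_n$ with RJS form $$\mathcal{J}_M=I_h\oplus E_{\theta_1}^{\oplus m_1}\oplus\dots\oplus E_{\theta_r}^{\oplus m_r}\oplus(-I_{2k}),$$ where $h,r,k\ge0$, $m_j>0$ for all $j$, $h+2m_1+\dots+2m_r+2k=n$ and $0<\theta_1<\dots<\theta_r<\pi$, and let $C_0\in\mathcal{O}_n$ be such that $M=C_0\mathcal{J}_MC_0^T$. For every $0\le u\le h$ and $0\le\mu_j\le m_j$, $1\le j\le r$, let $$\widetilde{\mathcal{J}}:=I_u\oplus(-I_{h-u})\oplus E_{\frac12\theta_1}^{\oplus\mu_1}\oplus E_{(\frac12\theta_1-\pi)}^{\oplus(m_1-\mu_1)}\oplus\dots\oplus E_{\frac12\theta_r}^{\oplus\mu_r}\oplus E_{(\frac12\theta_r-\pi)}^{\oplus(m_r-\mu_r)}\oplus E_{\frac{\pi}{2}}^{\oplus k}.$$ Then $$\mathcal{OSR}(M)_u^{(\mu_1,\dots,\mu_r)}=\{C_0X\widetilde{\mathcal{J}}X^TC_0^T:X\in\mathcal{C}_{\mathcal{J}_M}\cap\mathcal{O}_n\}=\Gamma_{C_0}\big(\mathcal{OSR}(\mathcal{J}_M)_u^{(\mu_1,\dots,\mu_r)}\big),$$ where $$\mathcal{OSR}(\mathcal{J}_M)_u^{(\mu_1,\dots,\mu_r)}=\big[\mathcal{O}_h\cap GLSym_h(u)\big]\oplus\Big[\bigoplus_{j=1}^r\exp\big(\tfrac12\mathbf{i}\theta_j\big)\big(U_{m_j}\cap Herm_{m_j}(\mu_j)\big)\Big]\oplus\big[\mathcal{O}_{2k}\cap\mathfrak{so}_{2k}\big].$$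 Moreover $\mathcal{OSR}(M)_u^{(\mu_1,\dots,\mu_r)}$ is a compact submanifold of $\mathcal{O}_n$, diffeomorphic to the homogeneous space $\dfrac{\mathcal{C}_{\mathcal{J}_M}\cap\mathcal{O}_n}{\mathcal{C}_{\widetilde{\mathcal{J}}}\cap\mathcal{O}_n}$.
   Context: $GL_n$ is the group of real non-singular $n\times n$ matrices; $\mathcal{O}_n$ (resp. $S\mathcal{O}_n$) the real orthogonal (resp. special orthogonal) group; $\mathfrak{so}_n$ the space of real skew-symmetric $n\times n$ matrices; $U_n$ the group of complex unitary $n\times n$ matrices; $GLSym_n(q)$ the set of non-singular real symmetric $n\times n$ matrices with $q$ positive and $n-q$ negative eigenvalues; $Herm_n(\mu)$ the set of non-singular complex hermitian $n\times n$ matrices with $\mu$ positive and $n-\mu$ negative eigenvalues. For $B\in GL_n$, $\mathcal{C}_B:=\{X\in GL_n:BX=XB\}$. For $C_0\in GL_n$, $\Gamma_{C_0}(X):=C_0XC_0^T$. $E_\theta:=\begin{pmatrix}\cos\theta&-\sin\theta\\ \sin\theta&\cos\theta\end{pmatrix}$. $\oplus$ denotes block-diagonal sum, $B^{\oplus m}$ is $B\oplus\dots\oplus B$ ($m$ times); for sets of square matrices, $\mathcal{S}_1\oplus\dots\oplus\mathcal{S}_m$ is the set of all $B_1\oplus\dots\oplus B_m$ with $B_j\in\mathcal{S}_j$; blocks of size $0$ are omitted. Complex $m\times m$ matrices are regarded as real $2m\times2m$ matrices through the monomorphism $\rho_m$ replacing each entry $z$ by the $2\times2$ real block $\begin{pmatrix}\mathrm{Re}\,z&-\mathrm{Im}\,z\\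 \mathrm{Im}\,z&\mathrm{Re}\,z\end{pmatrix}$; in particular $\exp(\frac12\mathbf{i}\theta_j)(U_{m_j}\cap Herm_{m_j}(\mu_j))$ is regarded as a set of real matrices of order $2m_j$. Every $M\in S\mathcal{O}_n$ has a real Jordan standard form (RJS form) $\mathcal{J}_M$ of the type displayed in the claim, and $M=C_0\mathcal{J}_MC_0^T$ for some $C_0\in\mathcal{O}_n$; equivalently, the eigenvalues of $M$ are $1$ with multiplicity $h$, $\exp(\pm\mathbf{i}\theta_j)$ both with multiplicity $m_j$, and $-1$ with multiplicity $2k$. $\mathcal{OSR}(M)$ is the set of all $Y\in\mathcal{O}_n$ with $Y^2=M$, and $\mathcal{OSR}(M)_u^{(\mu_1,\dots,\mu_r)}$ is the subset of those $Y\in\mathcal{OSR}(M)$ whose eigenvalues are: $1$ with multiplicity $u$, $-1$ with multiplicity $h-u$, $\exp(\pm\frac12\mathbf{i}\theta_j)$ both with multiplicity $\mu_j$ and $\exp(\pm\mathbf{i}(\frac12\theta_j-\pi))$ both with multiplicity $m_j-\mu_j$ for $1\le j\le r$, and $\pm\mathbf{i}$ both with multiplicity $k$ (equivalently, $Y=H\widetilde{\mathcal{J}}H^T$ for some $H\in\mathcal{O}_n$). The index $u$ and/or the family $(\mu_1,\dots,\mu_r)$ may be absent (when $h=0$ and/or $r=0$), in which case they are omitted from the notation. One has $\widetilde{\mathcal{J}}^2=\mathcal{J}_M$, hence $\mathcal{C}_{\widetilde{\mathcal{J}}}\subseteq\mathcal{C}_{\mathcal{J}_M}$. *)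

(* Defs.v *)
From HB Require Import structures.
From mathcomp Require Import all_boot all_order all_algebra.
From mathcomp Require Import all_classical all_reals all_analysis.
From mathcomp Require Import complex.

Set Implicit Arguments.
Unset Strict Implicit.
Unset Printing Implicit Defensive.

Import Order.TTheory GRing.Theory Num.Theory.
Import numFieldNormedType.Exports.

Local Open Scope classical_set_scope.
Local Open Scope ring_scope.

(** * Smooth maps and smooth manifolds *)

Section Smooth.
Context {R : realType}.

(** [f] is of class C^k on the open set [O], for [E] finite-dimensional. *)
Fixpoint Ck_on {E F : normedModType R} (k : nat) (O : set E) (f : E -> F) : Prop :=
  if k is k'.+1 then
    (forall x, O x -> differentiable f x) /\
    (forall v : E, Ck_on k' O (fun x => 'd f x v))
  else forall x, O x -> {for x, continuous f}.

Definition smooth_on {E F : normedModType R} (O : set E) (f : E -> F) : Prop :=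
  forall k, Ck_on k O f.

(** Smoothness on an arbitrary subset: local smooth extendability. *)
Definition smooth_within {E F : normedModType R} (S : set E) (f : E -> F) : Prop :=
  forall x, S x -> exists O (g : E -> F),
    [/\ open O, O x, smooth_on O g & forall y, S y -> O y -> f y = g y].

(** A [d]-dimensional chart: its domain and its coordinate map, whose values
    outside the domain are irrelevant. *)
Definition chart (T : Type) (d : nat) : Type := (set T * (T -> 'rV[R]_d))%type.

(** Open sets of the topology that a set of charts puts on [X]. *)
Definition atlas_open {T : Type} {d : nat} (X : set T) (A : set (chart T d))
    (W : set T) : Prop :=
  W `<=` X /\ forall c, A c -> open (c.2 @` (W `&` c.1)).

(** [A] makes [X] a (Hausdorff, second countable) smooth [d]-manifold. *)
Definition smooth_atlas {T : Type} {d : nat} (X : set T) (A : set (chart T d)) : Prop :=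
  [/\ forall c, A c -> [/\ c.1 `<=` X, set_inj c.1 c.2 & open (c.2 @` c.1)],
      forall x, X x -> exists2 c, A c & c.1 x,
      forall c c', A c -> A c' ->
        open (c.2 @` (c.1 `&` c'.1)) /\
        exists2 g : 'rV[R]_d -> 'rV[R]_d, smooth_on (c.2 @` (c.1 `&` c'.1)) g &
          forall x, c.1 x -> c'.1 x -> c'.2 x = g (c.2 x),
      forall x y, X x -> X y -> x <> y -> exists U V,
        [/\ atlas_open X A U, atlas_open X A V, U x, V y & U `&` V = set0] &
      exists2 B : set (set T), countable B &
        B `<=` atlas_open X A /\
        forall W x, atlas_open X A W -> W x -> exists2 b, B b & b x /\ b `<=` W].

(** Near [x], [g] is the expression of [f] in the charts [c] and [c']. *)
Definition coord_rep {T T' : Type} {d d' : nat} (c : chart T d) (c' : chart T' d')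
    (f : T -> T') (x : T) (g : 'rV[R]_d -> 'rV[R]_d') : Prop :=
  [/\ c.1 x, c'.1 (f x) & exists O, [/\ open O, O (c.2 x), smooth_on O g &
    forall y, c.1 y -> O (c.2 y) -> c'.1 (f y) /\ c'.2 (f y) = g (c.2 y)]].

Definition smooth_map {T T' : Type} {d d' : nat}
    (X : set T) (A : set (chart T d)) (X' : set T') (A' : set (chart T' d'))
    (f : T -> T') : Prop :=
  forall x, X x -> X' (f x) /\
    exists c c' g, [/\ A c, A' c' & coord_rep c c' f x g].

Definition submersion {T T' : Type} {d d' : nat}
    (X : set T) (A : set (chart T d)) (X' : set T') (A' : set (chart T' d'))
    (f : T -> T') : Prop :=
  forall x, X x -> X' (f x) /\
    exists c c' g, [/\ A c, A' c', coord_rep c c' f x g &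
      forall w, exists v, 'd g (c.2 x) v = w].

Definition diffeomorphic {T T' : Type} {d d' : nat}
    (X : set T) (A : set (chart T d)) (X' : set T') (A' : set (chart T' d')) : Prop :=
  exists (f : T -> T') (g : T' -> T),
    [/\ smooth_map X A X' A' f, smooth_map X' A' X A g,
        forall x, X x -> g (f x) = x & forall y, X' y -> f (g y) = y].

(** The charts of a subset [S] of a normed space, for its embedded structure:
    diffeomorphisms from a relatively open part of [S] to an open set of R^d. *)
Definition embedded_atlas {E : normedModType R} (S : set E) (d : nat) : set (chart E d) :=
  [set c | [/\ exists2 O, open O & c.1 = S `&` O,
               open (c.2 @` c.1),
               smooth_within c.1 c.2 &
               exists2 psi : 'rV[R]_d -> E, smooth_on (c.2 @` c.1) psi &
                 forall x, c.1 x -> psi (c.2 x) = x]].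
Arguments embedded_atlas {E} S d.

Definition embedded_manifold {E : normedModType R} (S : set E) (d : nat) : Prop :=
  forall x, S x -> exists2 c, embedded_atlas S d c & c.1 x.

(** [S] is a [d]-dimensional (embedded) submanifold of [N], itself a
    submanifold of the ambient space. *)
Definition submanifold {E : normedModType R} (N S : set E) (d : nat) : Prop :=
  [/\ S `<=` N, exists e, embedded_manifold N e & embedded_manifold S d].

End Smooth.

Arguments embedded_atlas {R E} S d.

(** * Matrix groups and homogeneous spaces *)

Section MatrixSets.
Variable R : realType.

Definition On (n : nat) : set 'M[R]_n := [set X | X *m X^T = 1%:M].
Definition SOn (n : nat) : set 'M[R]_n := [set X | @On n X /\ \det X = 1].
Definition so (n : nat) : set 'M[R]_n := [set X | X^T = - X].
Definition Un (n : nat) : set 'M[R[i]]_n := [set Z | Z \is unitarymx].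
Definition centralizer (n : nat) (B : 'M[R]_n) : set 'M[R]_n :=
  [set X | X \in unitmx /\ B *m X = X *m B].
Definition Gamma (n : nat) (C X : 'M[R]_n) : 'M[R]_n := C *m X *m C^T.

(** [p] positive and [q] negative eigenvalues, counted with multiplicity.  Over
    the complex numbers [0 < x] means that [x] is real and positive. *)
Definition inertia {F : numDomainType} {n : nat} (A : 'M[F]_n) (p q : nat) : Prop :=
  exists s : seq F,
    [/\ char_poly A = \prod_(x <- s) ('X - x%:P),
        count (fun x => 0 < x) s = p & count (fun x => x < 0) s = q].

Definition GLSym (n q : nat) : set 'M[R]_n :=
  [set A | [/\ A \in unitmx, A^T = A & inertia A q (n - q)]].
Definition Herm (n q : nat) : set 'M[R[i]]_n :=
  [set A | [/\ A \in unitmx, A \is hermsymmx & inertia A q (n - q)]].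

(** The homogeneous space G/H as the set of left cosets gH. *)
Definition coset_map (n : nat) (H : set 'M[R]_n) (g : 'M[R]_n) : set 'M[R]_n :=
  [set g *m x | x in H].
Definition quotient_set (n : nat) (G H : set 'M[R]_n) : set (set 'M[R]_n) :=
  coset_map H @` G.

(** The smooth structure of G/H is characterized, uniquely up to equivalence of
    atlases, by the projection G -> G/H being a smooth submersion. *)
Definition homogeneous_atlas (n : nat) (G H : set 'M[R]_n) (d : nat)
    (A : set (chart (set 'M[R]_n) d)) : Prop :=
  smooth_atlas (quotient_set G H) A /\
  exists e, embedded_manifold G e /\
    submersion G (embedded_atlas G e) (quotient_set G H) A (coset_map H).

End MatrixSets.

Arguments On R n : clear implicits.
Arguments SOn R n : clear implicits.
Arguments so R n : clear implicits.
Arguments Un R n : clear implicits.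
Arguments GLSym R n q : clear implicits.
Arguments Herm R n q : clear implicits.

(** * Real Jordan forms and orthogonal square roots *)

Section RealJordan.
Context {R : realType}.

Definition cexpi (t : R) : R[i] := Complex (cos t) (sin t).

Definition block2 (a b : R) : 'M[R]_2 :=
  \matrix_(i < 2, j < 2) if i == j then a else if (i < j)%N then - b else b.

Definition rot (t : R) : 'M[R]_2 := block2 (cos t) (sin t).

(** A direct sum of [m] blocks of size 2 has order [\sum_(i < m) 2 = 2 * m]:
    this is the type given by [\mxdiag] and [\mxblock]. *)
Definition dbl (m : nat) : nat := (\sum_(i < m) 2)%N.

(** The monomorphism rho_m. *)
Definition realify (m : nat) (Z : 'M[R[i]]_m) : 'M[R]_(dbl m) :=
  \mxblock_(a < m, b < m) block2 (complex.Re (Z a b)) (complex.Im (Z a b)).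

(** [h + 2 m_1 + ... + 2 m_r + 2 k], see [rjs_orderE] below. *)
Definition rjs_order (h r : nat) (m : 'I_r -> nat) (k : nat) : nat :=
  (h + \sum_(j < r) dbl (m j) + dbl k)%N.

Definition dsum3 (p q s : nat) (A : 'M[R]_p) (B : 'M[R]_q) (C : 'M[R]_s) :
    'M[R]_(p + q + s) :=
  block_mx (block_mx A 0 0 B) 0 0 C.

Definition RJS (h r : nat) (m : 'I_r -> nat) (k : nat) (theta : 'I_r -> R) :
    'M[R]_(rjs_order h m k) :=
  dsum3 1%:M (\mxdiag_(j < r) \mxdiag_(i < m j) rot (theta j)) (- 1%:M).

(** The matrix J~; the two groups of blocks [rot (theta_j / 2)] and
    [rot (theta_j / 2 - pi)] are told apart by the rank of the block. *)
Definition RJSt (h r : nat) (m : 'I_r -> nat) (k : nat) (theta : 'I_r -> R)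
    (u : nat) (mu : 'I_r -> nat) : 'M[R]_(rjs_order h m k) :=
  dsum3 (diag_mx (\row_(i < h) if (i < u)%N then 1 else - 1))
        (\mxdiag_(j < r) \mxdiag_(a < m j)
           rot (if (a < mu j)%N then theta j / 2 else theta j / 2 - pi))
        (\mxdiag_(i < k) rot (pi / 2)).

(** ('X - e^{it}) ('X - e^{-it}) *)
Definition conj_pair (t : R) : {poly R[i]} :=
  ('X - (cexpi t)%:P) * ('X - (cexpi (- t))%:P).

Definition OSR (n : nat) (M : 'M[R]_n) : set 'M[R]_n :=
  [set Y | On R n Y /\ Y *m Y = M].

(** OSR(M)_u^(mu_1, ..., mu_r); the eigenvalues of [Y] with their
    multiplicities are read off its complex characteristic polynomial. *)
Definition OSRu (n : nat) (h r : nat) (m : 'I_r -> nat) (k : nat)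
    (theta : 'I_r -> R) (u : nat) (mu : 'I_r -> nat) (M : 'M[R]_n) : set 'M[R]_n :=
  [set Y | OSR M Y /\
    char_poly (map_mx (real_complex R) Y) =
      ('X - 1) ^+ u * ('X + 1) ^+ (h - u) *
      (\prod_(j < r) (conj_pair (theta j / 2) ^+ mu j *
                      conj_pair (theta j / 2 - pi) ^+ (m j - mu j))) *
      (('X - ('i%C)%:P) * ('X + ('i%C)%:P)) ^+ k].

Definition dsum_sets (h r : nat) (m : 'I_r -> nat) (k : nat)
    (SA : set 'M[R]_h) (SB : forall j : 'I_r, set 'M[R]_(dbl (m j)))
    (SC : set 'M[R]_(dbl k)) : set 'M[R]_(rjs_order h m k) :=
  [set Y | exists A B C, [/\ SA A, forall j, SB j (B j), SC C &
                             Y = dsum3 A (\mxdiag_(j < r) B j) C]].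

(** exp(i theta / 2) (U_m `&` Herm_m(mu)) as a set of real matrices. *)
Definition rotated_unitary_herm (m mu : nat) (theta : R) : set 'M[R]_(dbl m) :=
  [set realify (cexpi (theta / 2) *: Z) | Z in Un R m `&` Herm R m mu].

End RealJordan.

Arguments rotated_unitary_herm {R} m mu theta.

Lemma rjs_orderE (h r : nat) (m : 'I_r -> nat) (k : nat) :
  rjs_order h m k = (h + \sum_(j < r) 2 * m j + 2 * k)%N.
Proof.
rewrite /rjs_order /dbl sum_nat_const card_ord mulnC; congr (_ + _ + _)%N.
by apply: eq_bigr => j _; rewrite sum_nat_const card_ord mulnC.
Qed.

(* Main.v *)
Require Import Defs.
From HB Require Import structures.
From mathcomp Require Import all_boot all_order all_algebra.
From mathcomp Require Import fingroup perm.
From mathcomp Require Import all_classical all_reals all_analysis.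
From mathcomp Require Import complex.
From mathcomp Require Import ring lra.

(** Let [J] be the real Jordan form, [Jt] its given square root, [G] and [H] their
    centralizers in the orthogonal group, and [S] the set of square roots of
    M = C0 J C0^T with the prescribed eigenvalues.

    [S] is an orbit of [G].  Orthogonal matrices with the same complex characteristic
    polynomial are orthogonally similar ([orthogonal_similar_char_poly]: the spectral
    theorem gives a complex similarity, hence a real one, and [orthogonal_similar] makes
    it orthogonal by polar decomposition).  A similarity between two square roots of [J]
    commutes with [J].  Hence [S] consists of the C0 X Jt X^T C0^T with X in [G]
    ([OSRu_orbit]).

    For M = J the orbit is a direct sum.  A matrix in [G] commutes with J + J^T, which is
    block-scalar with distinct scalars 2, 2 cos theta_j, -2, so it is block-diagonal, and
    its middle blocks, commuting with a rotation that is not plus or minus 1, are complex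
    ([comm_On_RJS_block]).  Blockwise the orbit is made of conjugates of diagonal sign
    matrices, or of a complex structure; the spectral theorem recognizes these as the
    symmetric orthogonal, hermitian unitary and skew orthogonal matrices with the right
    inertia ([OSRu_RJSE]).

    [S] is a compact symmetric space, and the Cayley transform provides rational charts.
    If A and B are orthogonal square roots of [J] and 1 + B A^T is invertible, the Cayley
    transform of B A^T is skew and anticommutes with A.  Conversely, for K skew and
    anticommuting with A, the matrix B = cayley K A is a square root of [J], and
    (A + B) A = B (A + B) with A + B invertible shows that B lies in the same orbit
    ([orbit_of_anticomm]).  So around each of its points [S] is parametrized by the linear
    space of such K, and the action of [G] identifies these spaces with one another.  The
    group [G], and the orthogonal group as the case J = 1, have similar charts, with
    skew matrices commuting with [J] ([comm_On_manifold]).  All transition maps are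
    rational, so smoothness reduces to sums, products and inverses of scalar functions.

    The bijection g H |-> C0 g Jt g^T C0^T from G/H to [S] transports the charts of [S] to
    G/H ([smooth_atlas_pullback]) and is then a diffeomorphism.  That this is the quotient
    structure means that the projection is a submersion: in Cayley charts, in a
    direction K anticommuting with [Jt], it is K |-> 2 K (1 + K^2)^-1 ([cayley_square]),
    whose differential at 0 is twice the identity ([diff_orbit_rep]). *)

Set Implicit Arguments.
Unset Strict Implicit.
Unset Printing Implicit Defensive.

Import Order.TTheory GRing.Theory Num.Theory.
Import numFieldNormedType.Exports.

Local Open Scope classical_set_scope.
Local Open Scope ring_scope.
Local Open Scope sesquilinear_scope.

(** * C^k maps *)

Section SmoothCalculus.
Variables (R : realType) (E : normedModType R).
Implicit Types (O : set E) (k : nat).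

(** The differential is picked by a choice operator among all candidates, so its
    dependence on the germ of the map alone has to be derived from uniqueness. *)
Lemma near_eq_differentiable (F : normedModType R) (f g : E -> F) (x : E) :
  (\near x, f x = g x) -> differentiable f x ->
  differentiable g x /\ ('d g x = 'd f x :> (E -> F)).
Proof.
move=> fg df.
have fgx : f x = g x by exact: (nbhs_singleton fg).
have gE : g \o shift x = cst (g x) + 'd f x +o_ (0 : E) id.
  have /diff_locally dfE := df.
  apply/eqaddoP => e e0.
  have /eqaddoP /(_ e e0) dfe := dfE.
  have fg0 : \forall h \near (0 : E), f (h + x) = g (h + x).
    move: fg; rewrite (near_shift 0 x) /=.
    by apply: filterS => h /=; rewrite subr0 addrC.
  near=> h.
  have <- : (f \o shift x - (cst (f x) + 'd f x)) h =
            (g \o shift x - (cst (g x) + 'd f x)) h.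
    by rewrite !fctE /= -fgx (near fg0 h).
  by near: h.
have dg : 'd g x = 'd f x :> (E -> F).
  by apply: diff_unique => //; apply: diff_continuous.
split=> //; apply/diff_locallyP; rewrite dg; split=> //.
exact: diff_continuous.
Unshelve. all: by end_near. Qed.

Lemma eq_on_open_differentiable (F : normedModType R) (f g : E -> F) O (x : E) :
  open O -> O x -> (forall y, O y -> f y = g y) -> differentiable f x ->
  differentiable g x /\ ('d g x = 'd f x :> (E -> F)).
Proof.
move=> oO Ox fg; apply: near_eq_differentiable.
have : nbhs x O by apply: open_nbhs_nbhs; split.
exact: filterS.
Qed.

(** Being of class C^k iterates the differential over all of [O], so that a formula
    for the differential valid on [O] only may be substituted at each step. *)
Lemma Ck_on_eq (F : normedModType R) k (f g : E -> F) O :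
  open O -> (forall y, O y -> f y = g y) -> Ck_on k O f -> Ck_on k O g.
Proof.
move=> oO; elim: k f g => [|k IH] f g fg /=.
  move=> cf x Ox; have cfx : f x' @[x' --> x] --> f x := cf x Ox.
  suff: g x' @[x' --> x] --> g x by [].
  rewrite -fg //; apply: cvg_trans cfx; apply: near_eq_cvg.
  have : nbhs x O by apply: open_nbhs_nbhs; split.
  exact: filterS.
move=> [df ckf]; split=> [x Ox|v].
  by have [] := eq_on_open_differentiable oO Ox fg (df x Ox).
apply: IH (ckf v) => x Ox.
by have [_ ->] := eq_on_open_differentiable oO Ox fg (df x Ox).
Qed.

Lemma Ck_onW (F : normedModType R) k (f : E -> F) O : Ck_on k.+1 O f -> Ck_on k O f.
Proof.
elim: k f => [|k IH] f /= [df ckf].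
  by move=> x Ox; exact/differentiable_continuous/df.
by split=> // v; apply: IH.
Qed.

Lemma Ck_on_subset (F : normedModType R) k (f : E -> F) (O O' : set E) :
  O' `<=` O -> Ck_on k O f -> Ck_on k O' f.
Proof.
move=> sO; elim: k f => [|k IH] f /=; first by move=> cf x /sO; apply: cf.
by move=> [df ckf]; split=> [x /sO/df//|v]; apply: IH.
Qed.

Lemma Ck_on_cst (F : normedModType R) k (a : F) O : Ck_on k O (fun=> a).
Proof.
elim: k a => [|k IH] a /=; first by move=> x _; exact: cst_continuous.
split=> [x _|v]; first exact: differentiable_cst.
rewrite (_ : (fun x => _) = fun=> 0) //; apply/funext => x.
by have /(congr1 (@^~ v)) := diff_cst a x.
Qed.

Lemma Ck_onD (F : normedModType R) k (f g : E -> F) O : open O ->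
  Ck_on k O f -> Ck_on k O g -> Ck_on k O (fun x => f x + g x).
Proof.
move=> oO; elim: k f g => [|k IH] f g /=.
  by move=> cf cg x Ox; apply: cvgD; [exact: cf|exact: cg].
move=> [df ckf] [dg ckg]; split=> [x Ox|v].
  by apply: (differentiableD (df x Ox) (dg x Ox)).
apply: (Ck_on_eq oO _ (IH _ _ (ckf v) (ckg v))) => x Ox.
by have /(congr1 (@^~ v)) /= /esym := diffD (df x Ox) (dg x Ox).
Qed.

Lemma Ck_on_sum (F : normedModType R) (I : Type) (s : seq I) (P : pred I) k
    (f : I -> E -> F) O : open O ->
  (forall i, Ck_on k O (f i)) -> Ck_on k O (fun x => \sum_(i <- s | P i) f i x).
Proof.
move=> oO ckf; elim: s => [|i s IH].
  by under eq_fun do rewrite big_nil; apply: Ck_on_cst.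
under eq_fun do rewrite big_cons.
by case: (P i) => //; apply: Ck_onD.
Qed.

(** By Leibniz the differential is again a sum of products of maps of class C^k, the
    undifferentiated factors being of class C^k by [Ck_onW]. *)
Lemma Ck_onM k (f g : E -> R) O : open O ->
  Ck_on k O f -> Ck_on k O g -> Ck_on k O (fun x => f x * g x).
Proof.
move=> oO; elim: k f g => [|k IH] f g /=.
  by move=> cf cg x Ox; apply: cvgM; [exact: cf|exact: cg].
move=> [df ckf] [dg ckg]; split=> [x Ox|v].
  by apply: (differentiableM (df x Ox) (dg x Ox)).
have ckfW : Ck_on k O f := Ck_onW (conj df ckf).
have ckgW : Ck_on k O g := Ck_onW (conj dg ckg).
apply: (Ck_on_eq oO _ (Ck_onD oO (IH _ _ ckfW (ckg v)) (IH _ _ ckgW (ckf v)))).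
move=> x Ox.
by have /(congr1 (@^~ v)) /= /esym := diffM (df x Ox) (dg x Ox).
Qed.

Lemma Ck_on_prod (I : Type) (s : seq I) (P : pred I) k (f : I -> E -> R) O :
  open O -> (forall i, Ck_on k O (f i)) ->
  Ck_on k O (fun x => \prod_(i <- s | P i) f i x).
Proof.
move=> oO ckf; elim: s => [|i s IH].
  by under eq_fun do rewrite big_nil; apply: Ck_on_cst.
under eq_fun do rewrite big_cons.
by case: (P i) => //; apply: Ck_onM.
Qed.

(** The differential [- f^-2 df] involves the inverse once more, but one order lower. *)
Lemma Ck_onV k (f : E -> R) O : open O -> (forall x, O x -> f x != 0) ->
  Ck_on k O f -> Ck_on k O (fun x => (f x)^-1).
Proof.
move=> oO f0; elim: k => [|k IH] /=.
  by move=> cf x Ox; apply: cvgV; [exact: f0|exact: cf].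
move=> [df ckf]; split=> [x Ox|v].
  by apply: differentiableV; [exact: df|exact: f0].
have ckV : Ck_on k O (fun x => (f x)^-1) by exact: IH (Ck_onW (conj df ckf)).
pose g x := -1 * ((f x)^-1 * (f x)^-1 * 'd f x v).
have ckg : Ck_on k O g.
  apply: Ck_onM => //; first exact: Ck_on_cst.
  by apply: Ck_onM => //; apply: Ck_onM.
apply: (@Ck_on_eq _ _ g) => // x Ox.
rewrite (diffV (df x Ox) (f0 x Ox)) /g /=.
by rewrite mulN1r -invfM -expr2 -mulNr.
Qed.

End SmoothCalculus.

(** * Smooth maps into matrix spaces *)

Section SmoothMatrices.
Variables (R : realType) (E : normedModType R).
Implicit Types (O : set E) (k : nat).

(** The differential of a continuous linear map is the map itself, hence the
    induction stays inside maps of the form [L \o f]. *)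
Lemma Ck_on_linear_comp (F G : normedModType R) (L : {linear F -> G}) k
    (f : E -> F) O : open O -> continuous L -> Ck_on k O f -> Ck_on k O (L \o f).
Proof.
move=> oO cL; elim: k f => [|k IH] f.
  move=> cf x Ox; have cfx : f x' @[x' --> x] --> f x := cf x Ox.
  by have := continuous_comp (cf x Ox) (cL (f x)).
move=> [df ckf]; split=> [x Ox|v].
  apply: differentiable_comp; first exact: df.
  exact: linear_differentiable.
apply: Ck_on_eq oO _ (IH _ (ckf v)) => x Ox /=.
have /(congr1 (@^~ v)) /= -> := diff_comp (df x Ox) (linear_differentiable (f x) cL).
by have /(congr1 (@^~ ('d f x v))) /= -> := diff_lin (f x) cL.
Qed.

Lemma Ck_onZl (F : normedModType R) k (f : E -> R) (w : F) O :
  open O -> Ck_on k O f -> Ck_on k O (fun x => f x *: w).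
Proof.
move=> oO ckf.
have lin : linear (fun r : R => r *: w) by move=> a b c; rewrite scalerDl scalerA.
pose LM := GRing.isLinear.Build _ _ _ _ _ lin.
pose L : {linear R -> F} := HB.pack (fun r : R => r *: w) LM.
apply: (@Ck_on_linear_comp _ _ L) => //; exact: scalel_continuous.
Qed.

Lemma smooth_on_id O : smooth_on O (@id E).
Proof.
case=> [|k]; first by move=> x _; exact: cvg_id.
split=> [x _|v]; first exact: ex_diff.
rewrite (_ : (fun x => _) = fun=> v); first exact: Ck_on_cst.
by apply/funext => x;
  have /(congr1 (@^~ v)) /= -> := @diff_val _ _ _ _ _ _ _ (is_diff_id x).
Qed.

Lemma smooth_on_cst (F : normedModType R) O (a : F) : smooth_on O (fun=> a : F).
Proof. by move=> k; exact: Ck_on_cst. Qed.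

Lemma smooth_onD (F : normedModType R) O (f g : E -> F) : open O ->
  smooth_on O f -> smooth_on O g -> smooth_on O (fun x => f x + g x).
Proof. by move=> oO sf sg k; apply: Ck_onD. Qed.

Lemma smooth_on_eq (F : normedModType R) O (f g : E -> F) : open O ->
  (forall x, O x -> f x = g x) -> smooth_on O f -> smooth_on O g.
Proof. by move=> oO fg sf k; apply: Ck_on_eq oO fg (sf k). Qed.

Lemma smooth_on_subset (F : normedModType R) (O O' : set E) (f : E -> F) :
  O' `<=` O -> smooth_on O f -> smooth_on O' f.
Proof. by move=> sO sf k; apply: Ck_on_subset sO (sf k). Qed.

Lemma smooth_on_continuous (F : normedModType R) O (f : E -> F) x :
  smooth_on O f -> O x -> {for x, continuous f}.
Proof. by move=> /(_ 0) sf; apply: sf. Qed.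

Lemma smooth_on_differentiable (F : normedModType R) O (f : E -> F) x :
  smooth_on O f -> O x -> differentiable f x.
Proof. by move=> /(_ 1) [sf _]; apply: sf. Qed.

Lemma smooth_on_linear_comp (F G : normedModType R) (L : {linear F -> G})
    (f : E -> F) O : open O -> continuous L -> smooth_on O f ->
  smooth_on O (L \o f).
Proof. by move=> oO cL sf k; apply: Ck_on_linear_comp. Qed.

(** Entries reduce the calculus of matrix-valued maps to that of scalar ones. *)
Lemma smooth_on_mxP p q (f : E -> 'M[R]_(p, q)) O : open O ->
  smooth_on O f <-> forall i j, smooth_on O (fun x => f x i j).
Proof.
move=> oO; split=> [sf i j|sf].
  have lin : linear (fun A : 'M[R]_(p, q) => A i j : R) by move=> a A B; rewrite !mxE.
  pose LM := GRing.isLinear.Build _ _ _ _ _ lin.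
  pose L : {linear 'M[R]_(p, q) -> R} := HB.pack (fun A : 'M[R]_(p, q) => A i j) LM.
  apply: (@smooth_on_linear_comp _ _ L) => //; exact: coord_continuous.
have -> : f = (fun x => \sum_i \sum_j f x i j *: delta_mx i j).
  by apply/funext => x; rewrite [LHS]matrix_sum_delta.
move=> k; apply: Ck_on_sum => // i; apply: Ck_on_sum => // j.
by apply: Ck_onZl => //; exact: sf.
Qed.

Lemma smooth_on_mulmx p q s (f : E -> 'M[R]_(p, q)) (g : E -> 'M[R]_(q, s)) O :
  open O -> smooth_on O f -> smooth_on O g -> smooth_on O (fun x => f x *m g x).
Proof.
move=> oO sf sg; apply/smooth_on_mxP => // i j.
under eq_fun do rewrite mxE.
move=> k; apply: Ck_on_sum => // l; apply: Ck_onM => //.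
  exact: ((smooth_on_mxP f oO).1 sf).
exact: ((smooth_on_mxP g oO).1 sg).
Qed.

Lemma smooth_on_det n (f : E -> 'M[R]_n) O :
  open O -> smooth_on O f -> smooth_on O (fun x => \det (f x)).
Proof.
move=> oO /smooth_on_mxP sf k; rewrite /determinant.
apply: Ck_on_sum => // s; apply: Ck_onM => //; first exact: Ck_on_cst.
by apply: Ck_on_prod => // i; apply: sf.
Qed.

(** Cramer's formula exhibits the inverse as a rational map of the entries. *)
Lemma smooth_on_invmx n (f : E -> 'M[R]_n) O : open O ->
  (forall x, O x -> f x \in unitmx) ->
  smooth_on O f -> smooth_on O (fun x => invmx (f x)).
Proof.
move=> oO fu sf.
apply: (@smooth_on_eq _ _ (fun x => (\det (f x))^-1 *: \adj (f x))) => //.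
  by move=> x /fu fxu; rewrite /invmx fxu.
apply/smooth_on_mxP => // i j.
under eq_fun do rewrite !mxE /cofactor.
move=> k; apply: Ck_onM => //.
  apply: Ck_onV => //; last exact: smooth_on_det.
  by move=> x /fu; rewrite unitmxE unitfE.
apply: Ck_onM => //; first exact: Ck_on_cst.
apply: smooth_on_det => //; apply/smooth_on_mxP => // a b.
under eq_fun do rewrite !mxE.
exact: ((smooth_on_mxP f oO).1 sf).
Qed.

End SmoothMatrices.

(** In finite dimension a linear map is a sum of scaled coordinate functions. *)
Lemma continuous_linear_mx (R : realType) p q (F : normedModType R)
  (L : {linear 'M[R]_(p, q) -> F}) : continuous L.
Proof.
have -> : L = (fun A => \sum_i \sum_j A i j *: L (delta_mx i j)) :> (_ -> _).
  apply/funext => A; rewrite [in LHS](matrix_sum_delta A) raddf_sum.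
  apply: eq_bigr => i _; rewrite raddf_sum; apply: eq_bigr => j _.
  exact: linearZ.
suff ck :
    Ck_on 0 setT (fun A : 'M[R]_(p, q) => \sum_i \sum_j A i j *: L (delta_mx i j)).
  by move=> A; exact: ck.
apply: Ck_on_sum => [|i]; first exact: openT.
apply: Ck_on_sum => [|j]; first exact: openT.
apply: Ck_onZl; first exact: openT.
by move=> A _; exact: coord_continuous.
Qed.

Lemma smooth_on_linear_mx (R : realType) (E : normedModType R) p q p' q'
    (L : {linear 'M[R]_(p, q) -> 'M[R]_(p', q')})
    (f : E -> 'M[R]_(p, q)) O : open O -> smooth_on O f ->
  smooth_on O (fun x => L (f x)).
Proof.
move=> oO; apply: smooth_on_linear_comp => //; exact: continuous_linear_mx.
Qed.

(** * The Cayley transform *)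

Section CayleyTransform.
Variables (R : realType) (n : nat).
Implicit Types X Y K J A : 'M[R]_n.

Lemma invmx_of_mulmx1 X Y : X *m Y = 1%:M -> invmx X = Y.
Proof.
by move=> XY; have [Xu _] := mulmx1_unit XY; rewrite -[RHS](mulKmx Xu) XY mulmx1.
Qed.

(** This is (1 - X)(1 + X)^-1.  With a single occurrence of the inverse,
    transposition and intertwining become immediate. *)
Definition cayley X : 'M[R]_n := 2 *: invmx (1%:M + X) - 1%:M.

Lemma cayley1D X : 1%:M + cayley X = 2 *: invmx (1%:M + X).
Proof. by rewrite /cayley addrC subrK. Qed.

Lemma unitmx_cayley1D X : 1%:M + X \in unitmx -> 1%:M + cayley X \in unitmx.
Proof. by move=> Xu; rewrite cayley1D unitmxZ ?unitfE ?pnatr_eq0 // unitmx_inv. Qed.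

Lemma cayleyK X : 1%:M + X \in unitmx -> cayley (cayley X) = X.
Proof.
move=> Xu; rewrite {1}/cayley cayley1D invmxZ ?invmxK; last first.
  by rewrite unitmxZ ?unitfE ?pnatr_eq0 // unitmx_inv.
by rewrite scalerA divff ?pnatr_eq0 // scale1r addrC addrA addNr add0r.
Qed.

Lemma tr_cayley X : (cayley X)^T = cayley X^T.
Proof. by rewrite /cayley linearB linearZ /= trmx_inv linearD /= !trmx1. Qed.

(** Used with [A] invertible but not central: it transports commutation as well as
    anticommutation relations through the Cayley transform. *)
Lemma cayley_intertwine A X Y : 1%:M + X \in unitmx -> 1%:M + Y \in unitmx ->
  A *m X = Y *m A -> A *m cayley X = cayley Y *m A.
Proof.
move=> Xu Yu AXY; rewrite /cayley mulmxBr mulmxBl mulmx1 mul1mx.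
congr (_ - _); rewrite -scalemxAr -scalemxAl; congr (_ *: _).
apply: (can_inj (mulmxK Xu)); rewrite mulmxKV //.
apply: (can_inj (mulKmx Yu)); rewrite !mulmxA mulmxV // mul1mx.
by rewrite mulmxDl mulmxDr mul1mx mulmx1 AXY.
Qed.

(** If v + vK = 0 then v v^T = - v K v^T, which vanishes as K is skew. *)
Lemma unitmx_1Dskew K : so R n K -> 1%:M + K \in unitmx.
Proof.
rewrite /so /= => Ks; rewrite -row_free_unit -kermx_eq0; apply/rowV0P => v.
move=> /sub_kermxP; rewrite mulmxDr mulmx1 => vK.
have vKv : v *m K *m v^T = 0.
  have : (v *m K *m v^T)^T = - (v *m K *m v^T).
    by rewrite !trmx_mul trmxK Ks mulNmx mulmxN mulmxA.
  move: (v *m K *m v^T) => s /matrixP sE; apply/matrixP => i j.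
  have := sE i j; rewrite !ord1 !mxE => /eqP.
  by rewrite eq_sym eqNr => /eqP.
have vv : v *m v^T = 0.
  by have := congr1 (mulmx^~ v^T) vK; rewrite /= mulmxDl vKv addr0 mul0mx.
apply/rowP => i; rewrite [RHS]mxE; apply/eqP.
move/matrixP/(_ 0 0): vv; rewrite !mxE => /eqP.
rewrite psumr_eq0 => [/allP /(_ i)|j _]; last by rewrite mxE -expr2 sqr_ge0.
by rewrite mem_index_enum mxE -expr2 sqrf_eq0; exact.
Qed.

(** With B = (1 + K)^-1 the claim amounts to B + B^T = 2 B B^T, which follows from
    (1 + K) + (1 + K^T) = 2. *)
Lemma cayley_orthogonal K : so R n K -> On R n (cayley K).
Proof.
move=> Ks; have Ku := unitmx_1Dskew Ks.
have KTu : 1%:M + K^T \in unitmx.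
  by rewrite -unitmx_tr linearD /= trmxK trmx1.
rewrite /On /= tr_cayley /cayley.
set B := invmx _; set B' := invmx _.
have e : B + B' = 2 *: (B *m B').
  have -> : B + B' = B *m (1%:M + K^T + (1%:M + K)) *m B'.
    by rewrite mulmxDr mulVmx // mulmxDl mulmxK // mul1mx.
  have -> : 1%:M + K^T + (1%:M + K) = 2%:R%:M.
    by rewrite Ks addrACA addNr addr0 -[2%:R]/(1 + 1) raddfD.
  by rewrite mul_mx_scalar -scalemxAl.
rewrite mulmxBl mulmxBr mul1mx mulmx1 -scalemxAr -!scalemxAl.
rewrite opprB addrA addrAC -[2 *: (2 *: _)]/(2 *: (2 *: _)) -e scalerDr.
by rewrite [_ + 2 *: B']addrC addrK subrr add0r.
Qed.

(** With B = (1 + X)^-1 the claim amounts to B + B^T = 1, which follows from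
    (1 + X) + (1 + X^T) = (1 + X)(1 + X^T). *)
Lemma cayley_skew X : On R n X -> 1%:M + X \in unitmx -> so R n (cayley X).
Proof.
move=> Xo Xu.
have XTu : 1%:M + X^T \in unitmx.
  by rewrite -unitmx_tr linearD /= trmxK trmx1.
rewrite /so /= tr_cayley /cayley.
set B := invmx (_ + X^T); set B' := invmx _.
have e : B' + B = 1%:M.
  have -> : B' + B = B' *m (1%:M + X^T + (1%:M + X)) *m B.
    by rewrite mulmxDr mulVmx // mulmxDl -mulmxA mulmxV // mul1mx mulmx1.
  have -> : 1%:M + X^T + (1%:M + X) = (1%:M + X) *m (1%:M + X^T).
    rewrite mulmxDl mul1mx mulmxDr mulmx1; congr (_ + _).
    by rewrite -[X *m X^T]/(X *m X^T) Xo addrC.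
  by rewrite mulmxA mulVmx // mul1mx mulmxV.
apply/eqP; rewrite -subr_eq0 opprK addrACA -scalerDr [B + B']addrC e.
by rewrite scaler_nat mulr2n -opprD subrr.
Qed.

Lemma cayley0 : cayley 0 = 1%:M.
Proof. by rewrite /cayley addr0 invmx1 scaler_nat mulr2n addrK. Qed.

Lemma cayley1 : cayley 1%:M = 0.
Proof.
by rewrite -{1}cayley0 cayleyK // addr0 unitmx1.
Qed.

(** The double-angle formula for the tangent: the Cayley transform takes a complex number
    of modulus 1 and argument t to - i tan (t / 2). *)
Lemma cayley_square K : 1%:M + K \in unitmx -> 1%:M + K *m K \in unitmx ->
  cayley (cayley K *m cayley K) = 2 *: (K *m invmx (1%:M + K *m K)).
Proof.
move=> Ku K2u; rewrite {1}/cayley.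
set B := invmx (1%:M + K).
have -> : 1%:M + cayley K *m cayley K = 2 *: (B *m (1%:M + K *m K) *m B).
  have -> : 1%:M + K *m K =
      (1%:M + K) *m (1%:M + K) - 2 *: (1%:M + K) + 2 *: 1%:M.
    rewrite mulmxDl mul1mx mulmxDr mulmx1 !scaler_nat !mulr2n.
    by apply/matrixP => i j; rewrite !mxE; ring.
  set U := 1%:M + K.
  have -> : B *m (U *m U - 2 *: U + 2 *: 1%:M) *m B =
      1%:M - 2 *: B + 2 *: (B *m B).
    rewrite mulmxDr mulmxBr -!scalemxAr mulmx1 mulmxA mulVmx // mul1mx.
    by rewrite mulmxDl mulmxBl -!scalemxAl mul1mx mulmxV.
  rewrite /cayley -/B mulmxBr mulmxBl mulmx1 mul1mx -scalemxAr -scalemxAl.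
  by apply/matrixP => i j; rewrite !mxE; ring.
have Bu : B \in unitmx by rewrite unitmx_inv.
rewrite invmxZ; last first.
  by rewrite unitmxZ ?unitfE ?pnatr_eq0 // !unitmx_mul Bu K2u.
rewrite scalerA divff ?pnatr_eq0 // scale1r.
have -> : invmx (B *m (1%:M + K *m K) *m B) =
    (1%:M + K) *m invmx (1%:M + K *m K) *m (1%:M + K).
  apply: invmx_of_mulmx1; rewrite -!mulmxA [B *m ((1%:M + K) *m _)]mulKmx //.
  by rewrite mulKVmx // mulVmx.
apply: (can_inj (mulmxK K2u)).
have comm : (1%:M + K) *m (1%:M + K *m K) = (1%:M + K *m K) *m (1%:M + K).
  by rewrite mulmxDl mul1mx mulmxDr mulmx1 mulmxDl mul1mx mulmxDr mulmx1 mulmxA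
    !addrA [1%:M + K + _]addrAC.
rewrite mulmxBl mul1mx -scalemxAl mulmxKV //.
rewrite -[_ *m _ *m (1%:M + K *m K)]mulmxA comm mulmxA mulmxKV //.
rewrite mulmxDl mul1mx mulmxDr mulmx1.
by apply/matrixP => i j; rewrite !mxE; ring.
Qed.

End CayleyTransform.

(** * Cayley charts *)

Lemma open_unitmx_preimage (R : realType) (E : normedModType R) n (f : E -> 'M[R]_n) O :
  open O -> smooth_on O f -> open (O `&` [set x | f x \in unitmx]).
Proof.
move=> oO sf; rewrite openE => x [Ox fx]; rewrite /interior.
have fx0 : \det (f x) != 0 by move: fx; rewrite /= unitmxE unitfE.
have cdet : {for x, continuous (fun x => \det (f x))}.
  exact: (smooth_on_continuous (smooth_on_det oO sf)).
have nO : nbhs x O by apply: open_nbhs_nbhs; split.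
have nd : nbhs x [set y | \det (f y) != 0] by exact: cvgr_neq0 cdet fx0.
by apply: filterS (filterI nO nd) => y [Oy dy]; split=> //=; rewrite unitmxE unitfE.
Qed.

Lemma smooth_on_cayley (R : realType) (E : normedModType R) n (f : E -> 'M[R]_n) O :
  open O -> (forall x, O x -> 1%:M + f x \in unitmx) -> smooth_on O f ->
  smooth_on O (fun x => cayley (f x)).
Proof.
move=> oO fu sf.
have s1 : smooth_on O (fun x => invmx (1%:M + f x)).
  apply: smooth_on_invmx => //; apply: smooth_onD => //; exact: smooth_on_cst.
apply: smooth_onD => //; last exact: smooth_on_cst.
exact: (smooth_on_linear_mx ( *:%R 2 : {linear 'M[R]_n -> 'M[R]_n}) oO s1).
Qed.

(** Linear coordinates on the common kernel of two linear maps; the coordinate map is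
    defined on all matrices, which spares extending it off the subspace. *)
Lemma linear_subspace_param (R : realType) n (f g : {linear 'M[R]_n -> 'M[R]_n}) :
  exists d (emb : {linear 'rV[R]_d -> 'M[R]_n}) (coord : {linear 'M[R]_n -> 'rV[R]_d}),
    [/\ forall v, f (emb v) = 0 /\ g (emb v) = 0, cancel emb coord &
        forall K, f K = 0 -> g K = 0 -> emb (coord K) = K].
Proof.
pose W := kermx (row_mx (lin_mx f) (lin_mx g)).
have WP K : reflect (f K = 0 /\ g K = 0) (mxvec K <= W)%MS.
  apply: (iffP sub_kermxP); rewrite mul_mx_row !mul_vec_lin.
    rewrite -[RHS]row_mx0 => /eq_row_mx [/(canRL mxvecK) -> /(canRL mxvecK) ->].
    by rewrite linear0.
  by move=> [-> ->]; rewrite linear0 row_mx0.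
pose P := row_base W.
exists (\rank W), (@vec_mx R n n \o mulmxr P), (mulmxr (pinvmx P) \o @mxvec R n n).
split=> [v|v|K fK gK] /=.
- by apply/WP; rewrite vec_mxK -(eq_row_base W) submxMl.
- by rewrite vec_mxK -mulmxA mulmxVp ?row_base_free // mulmx1.
- rewrite mulmxKpV ?mxvecK //; have /WP := conj fK gK.
  by rewrite eq_row_base.
Qed.

Lemma On_trmulmx (R : realType) n (X : 'M[R]_n) : On R n X -> X^T *m X = 1%:M.
Proof. by move=> /mulmx1C. Qed.

Section CayleyCharts.
Variables (R : realType) (n d : nat).
Variables (emb : {linear 'rV[R]_d -> 'M[R]_n}) (coord : {linear 'M[R]_n -> 'rV[R]_d}).
Hypothesis emb_skew : forall v, so R n (emb v).
Hypothesis embK : cancel emb coord.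

(** The Cayley transform centred at the orthogonal matrix [P^T *m Q^T]. *)
Definition cayley_chart (S : set 'M[R]_n) (P Q : 'M[R]_n) : chart 'M[R]_n d :=
  ([set Y | S Y /\ 1%:M + P *m Y *m Q \in unitmx],
   fun Y => coord (cayley (P *m Y *m Q))).

Definition cayley_param (P Q : 'M[R]_n) (v : 'rV[R]_d) : 'M[R]_n :=
  P^T *m cayley (emb v) *m Q^T.

(** Near [P^T *m Q^T], the set [S] corresponds under the Cayley transform to the whole
    linear subspace parametrized by [emb]. *)
Definition cayley_adapted (S : set 'M[R]_n) (P Q : 'M[R]_n) : Prop :=
  [/\ On R n P, On R n Q, forall v, S (cayley_param P Q v) &
      forall Y, S Y -> 1%:M + P *m Y *m Q \in unitmx ->
        emb (coord (cayley (P *m Y *m Q))) = cayley (P *m Y *m Q)].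

Lemma smooth_cayley_param P Q : smooth_on setT (cayley_param P Q).
Proof.
have oT := @openT 'rV[R]_d.
apply: smooth_on_mulmx => //; last exact: smooth_on_cst.
apply: smooth_on_mulmx => //; first exact: smooth_on_cst.
apply: smooth_on_cayley => // [v _|]; first exact/unitmx_1Dskew.
apply: smooth_on_linear_mx => //; exact: smooth_on_id.
Qed.

Lemma smooth_cayley_chart (E : normedModType R) (f : E -> 'M[R]_n) S P Q O :
  open O -> smooth_on O f ->
  let O' := O `&` [set x | 1%:M + P *m f x *m Q \in unitmx] in
  open O' /\ smooth_on O' (fun x => (cayley_chart S P Q).2 (f x)).
Proof.
move=> oO sf O'.
have s1 : smooth_on O (fun x => P *m f x *m Q).
  apply: smooth_on_mulmx => //; last exact: smooth_on_cst.
  by apply: smooth_on_mulmx => //; first exact: smooth_on_cst.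
have oO' : open O'.
  apply: open_unitmx_preimage => //; apply: smooth_onD => //; exact: smooth_on_cst.
split=> //=; apply: smooth_on_linear_mx => //.
apply: smooth_on_cayley => // [x []//|].
by apply: smooth_on_subset s1 => x [].
Qed.

Section OneChart.
Variables (S : set 'M[R]_n) (P Q : 'M[R]_n).
Hypothesis SPQ : cayley_adapted S P Q.
Let c := cayley_chart S P Q.

Lemma cayley_param_conj v : P *m cayley_param P Q v *m Q = cayley (emb v).
Proof.
have [Po Qo _ _] := SPQ.
by rewrite /cayley_param !mulmxA Po mul1mx -mulmxA On_trmulmx // mulmx1.
Qed.

Lemma cayley_param_dom v : c.1 (cayley_param P Q v).
Proof.
split; first by have [_ _ + _] := SPQ; exact.
rewrite cayley_param_conj; apply: unitmx_cayley1D; exact: unitmx_1Dskew.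
Qed.

Lemma cayley_chartK v : c.2 (cayley_param P Q v) = v.
Proof.
by rewrite /= cayley_param_conj cayleyK ?embK //; exact: unitmx_1Dskew.
Qed.

Lemma cayley_paramK Y : c.1 Y -> cayley_param P Q (c.2 Y) = Y.
Proof.
have [Po Qo _ pY] := SPQ; move=> [SY Yu].
rewrite /cayley_param /= pY // cayleyK // !mulmxA On_trmulmx // mul1mx.
by rewrite -mulmxA Qo mulmx1.
Qed.

Lemma cayley_chart_image (V : set 'M[R]_n) :
  c.2 @` (c.1 `&` V) = cayley_param P Q @^-1` V.
Proof.
apply/seteqP; split=> [_ [Y [cY VY] <-]|v Vv] /=.
  by rewrite /preimage /= cayley_paramK.
exists (cayley_param P Q v); last exact: cayley_chartK.
by split=> //; exact: cayley_param_dom.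
Qed.

Lemma cayley_chart_imageT : c.2 @` c.1 = setT.
Proof. by rewrite -[c.1]setIT cayley_chart_image. Qed.

(** The image of the chart is the whole coordinate space, and both the chart and its
    inverse are given by one rational formula. *)
Lemma cayley_chart_embedded : embedded_atlas S d c.
Proof.
have [oO sO] := smooth_cayley_chart S P Q (@openT _) (@smooth_on_id R 'M[R]_n setT).
split.
- exists [set Y | 1%:M + P *m Y *m Q \in unitmx]; last by [].
  by move: oO; rewrite setTI.
- rewrite cayley_chart_imageT; exact: openT.
- move=> Y [SY Yu]; exists (setT `&` [set Y | 1%:M + P *m Y *m Q \in unitmx]), c.2.
  by split.
- exists (cayley_param P Q); last exact: cayley_paramK.
  rewrite cayley_chart_imageT; exact: smooth_cayley_param.
Qed.

End OneChart.

Lemma cayley_chart_transition S P Q P' Q' :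
  let c := cayley_chart S P Q in let c' := cayley_chart S P' Q' in
  cayley_adapted S P Q -> cayley_adapted S P' Q' ->
  open (c.2 @` (c.1 `&` c'.1)) /\
  exists2 g : 'rV[R]_d -> 'rV[R]_d, smooth_on (c.2 @` (c.1 `&` c'.1)) g &
    forall x, c.1 x -> c'.1 x -> c'.2 x = g (c.2 x).
Proof.
move=> c c' ad ad'.
have [oO sO] := smooth_cayley_chart S P' Q' (@openT _) (smooth_cayley_param P Q).
have -> : c.2 @` (c.1 `&` c'.1) =
    setT `&` [set v | 1%:M + P' *m cayley_param P Q v *m Q' \in unitmx].
  rewrite cayley_chart_image // setTI; apply/seteqP; split=> v /=; first by case.
  by split=> //; have [_ _ + _] := ad; exact.
split=> //; exists (c'.2 \o cayley_param P Q) => //= x cx _.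
by congr (c'.2 _); rewrite (cayley_paramK ad cx).
Qed.

End CayleyCharts.

(** * Atlases pulled back along a bijection *)

(** Balls with rational centre and radius 1 / (k + 1). *)
Lemma countable_base_mx (R : realType) p q :
  exists2 B : set (set 'M[R]_(p, q)), countable B &
    B `<=` open /\ forall U x, open U -> U x -> exists2 b, B b & b x /\ b `<=` U.
Proof.
pose b (z : 'M[rat]_(p, q) * nat) : set 'M[R]_(p, q) :=
  ball (map_mx ratr z.1 : 'M[R]_(p, q)) (z.2.+1%:R^-1).
exists (range b).
  exact: sub_countable (card_image_le _ _) (countableP _).
split=> [_ [z _ <-]|U x oU Ux].
  exact: ball_open.
have : nbhs x U by apply: open_nbhs_nbhs; split.
move=> /nbhs_ballP [e /= e0 xeU].
(* A ball of radius 1 / (N + 1) containing [x] lies within 2 / (N + 1) of [x]. *)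
pose N := Num.truncn (2 / e).
have Ne : N.+1%:R^-1 + N.+1%:R^-1 <= e.
  rewrite -mulr2n -[leLHS]mulr_natl ler_pdivrMr ?ltr0n // mulrC -ler_pdivrMr //.
  exact/ltW/truncnS_gt.
have N0 : 0 < N.+1%:R^-1 :> R by rewrite invr_gt0.
have /choice [A0 hA0] : forall ij : 'I_p * 'I_q, exists a : rat,
    `|(ratr a : R) - x ij.1 ij.2| < N.+1%:R^-1.
  move=> [i j] /=.
  have := @rat_in_itvoo R (x i j - N.+1%:R^-1) (x i j + N.+1%:R^-1).
  case=> [|a]; first by rewrite ltrD2l (lt_trans _ N0) // oppr_lt0.
  rewrite in_itv /= => /andP[a1 a2]; exists a.
  by rewrite ltr_distl a1 a2.
pose A : 'M[rat]_(p, q) := \matrix_(i, j) A0 (i, j).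
exists (b (A, N)); first by exists (A, N).
have xA : ball (map_mx ratr A : 'M[R]_(p, q)) N.+1%:R^-1 x.
  by split=> // i j; rewrite !mxE; exact: hA0 (i, j).
split=> // y Ay; apply: xeU; apply: le_ball Ne _ _.
by apply: ball_triangle Ay; exact/ball_sym.
Qed.

Section PullbackAtlas.
Variables (R : realType) (n d : nat) (T : Type).
Variables (X : set T) (S : set 'M[R]_n) (F : T -> 'M[R]_n) (G : 'M[R]_n -> T).
Hypothesis FS : forall x, X x -> S (F x).
Hypothesis GX : forall Y, S Y -> X (G Y).
Hypothesis FK : forall x, X x -> G (F x) = x.
Hypothesis GK : forall Y, S Y -> F (G Y) = Y.

Definition pullback_chart (c : @chart R 'M[R]_n d) : @chart R T d :=
  (X `&` F @^-1` c.1, c.2 \o F).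

Variable C : set (@chart R 'M[R]_n d).
Hypothesis CS : C `<=` embedded_atlas S d.
Hypothesis C_cover : forall Y, S Y -> exists2 c, C c & c.1 Y.

Let A := pullback_chart @` C.

Lemma embedded_chart_sub (c : @chart R 'M[R]_n d) : embedded_atlas S d c -> c.1 `<=` S.
Proof. by move=> [[ O _ ->] _ _ _] x []. Qed.

Lemma pullback_image c (U : set 'M[R]_n) : C c ->
  (pullback_chart c).2 @` ((X `&` F @^-1` U) `&` (pullback_chart c).1) =
  c.2 @` (U `&` c.1).
Proof.
move=> /CS/embedded_chart_sub cS; apply/seteqP; split.
  by move=> _ [x [[Xx Ux] [_ cx]] <-]; exists (F x).
move=> _ [Y [UY cY] <-].
have SY := cS _ cY.
exists (G Y); last by rewrite /= GK.
have XGY := GX SY.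
by split; split=> //; rewrite /preimage /= GK.
Qed.

Lemma pullback_inj c : C c -> set_inj (pullback_chart c).1 (pullback_chart c).2.
Proof.
move=> /CS [_ _ _ [psi _ psiK]] x y; rewrite !inE => -[Xx cx] [Xy cy] /= /(congr1 psi).
by rewrite !psiK // => /(congr1 G); rewrite !FK.
Qed.

(** Together with the next lemma: the topology defined by the pulled back charts is the
    one induced by the ambient space of [S]. *)
Lemma atlas_open_pullback U : open U -> atlas_open X A (X `&` F @^-1` U).
Proof.
move=> oU; split=> [x []//|_ [c Cc <-]].
rewrite pullback_image //; have [_ oc _ [psi spsi psiK]] := CS Cc.
rewrite (_ : c.2 @` _ = (c.2 @` c.1) `&` psi @^-1` U); last first.
  apply/seteqP; split=> [_ [Y [UY cY] <-]|_ [[Y cY <-] Uv]].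
    by split; [exists Y|rewrite /preimage /= psiK].
  by exists Y => //; split=> //; move: Uv; rewrite /preimage /= psiK.
rewrite openE => v [cv Uv]; rewrite /interior.
apply: filterI; first by apply: open_nbhs_nbhs.
have := smooth_on_continuous spsi cv; apply.
by apply: open_nbhs_nbhs.
Qed.

Lemma atlas_open_pullback_sub W x : atlas_open X A W -> W x ->
  exists U, [/\ open U, U (F x) & X `&` F @^-1` U `<=` W].
Proof.
move=> [WX oW] Wx; have Xx := WX _ Wx.
have [c Cc cFx] := C_cover (FS Xx).
have Ac : A (pullback_chart c) by exists c.
have := oW _ Ac; set V := _ @` _ => oV.
have [[ O1 oO1 cE] _ sc [psi _ psiK]] := CS Cc.
have [ O [g [oO OFx sg cg]]] := sc _ cFx.
have gV : V (g (F x)).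
  exists x; first by split.
  by rewrite /= cg.
pose U0 := O `&` O1 `&` g @^-1` V.
have nU : nbhs (F x) U0.
  apply: filterI; first apply: filterI.
  - by apply: open_nbhs_nbhs.
  - apply: open_nbhs_nbhs; split=> //.
    by move: cFx; rewrite cE => -[].
  have := smooth_on_continuous sg OFx; apply.
  by apply: open_nbhs_nbhs.
exists (U0°); split; [exact: open_interior|exact: nU|].
move=> y [Xy /interior_subset [[ Oy O1y] [z [Wz [Xz cz]]]]] /=.
have cy : c.1 (F y) by rewrite cE; split=> //; exact: FS.
rewrite -cg // => /(congr1 psi); rewrite !psiK // => /(congr1 G).
by rewrite !FK // => <-.
Qed.

Lemma smooth_atlas_pullback :
  (forall c c', C c -> C c' ->
        open (c.2 @` (c.1 `&` c'.1)) /\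
        exists2 g : 'rV[R]_d -> 'rV[R]_d, smooth_on (c.2 @` (c.1 `&` c'.1)) g &
          forall x, c.1 x -> c'.1 x -> c'.2 x = g (c.2 x)) ->
  smooth_atlas X A.
Proof.
move=> trC; split.
- move=> _ [c Cc <-]; split; [by move=> x []|exact: pullback_inj|].
  have [_ oc _ _] := CS Cc.
  have := pullback_image c.1 Cc; by rewrite !setIid => ->.
- move=> x Xx; have [c Cc cx] := C_cover (FS Xx).
  by exists (pullback_chart c) => //; exists c.
- move=> _ _ [c Cc <-] [c' Cc' <-].
  have [oc [g sg cg]] := trC _ _ Cc Cc'.
  have -> : (pullback_chart c).2 @` ((pullback_chart c).1 `&` (pullback_chart c').1)
      = c.2 @` (c.1 `&` c'.1).
    by rewrite setIC pullback_image // setIC.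
  split=> //; exists g => // x [_ cx] [_ c'x] /=; exact: cg.
- move=> x y Xx Xy xy.
  have FxFy : F x != F y.
    by apply/eqP => /(congr1 G); rewrite !FK.
  have := @norm_hausdorff _ 'M[R]_n; rewrite open_hausdorff => /(_ _ _ FxFy).
  move=> [[U V] /= [Ux Vy] [oU oV UV]].
  exists (X `&` F @^-1` U), (X `&` F @^-1` V).
  split; [exact: atlas_open_pullback|exact: atlas_open_pullback| | |].
  + by split=> //; rewrite inE in Ux.
  + by split=> //; rewrite inE in Vy.
  + apply/seteqP; split=> // z [[_ Uz] [_ Vz]].
    have : (U `&` V) (F z) by [].
    by rewrite (eqP UV).
- have [B cB [Bo Bb]] := countable_base_mx R n n.
  exists ((fun b => X `&` F @^-1` b) @` B).
    exact: sub_countable (card_image_le _ _) cB.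
  split=> [_ [b Bb' <-]|W x oW Wx]; first by apply: atlas_open_pullback; exact: Bo.
  have [U [oU UFx XUW]] := atlas_open_pullback_sub oW Wx.
  have [b Bb' [bx bU]] := Bb _ _ oU UFx.
  exists (X `&` F @^-1` b); first by exists b.
  split; first by split=> //; exact: oW.1.
  by move=> y [Xy /bU Uy]; apply: XUW.
Qed.

Lemma diffeomorphic_pullback : diffeomorphic S (embedded_atlas S d) X A.
Proof.
exists G, F; split=> // [Y SY|x Xx].
  split; first exact: GX.
  have [c Cc cY] := C_cover SY.
  exists c, (pullback_chart c), id; split; [exact: CS|by exists c|].
  have XGY := GX SY.
  split=> //; first by split=> //; rewrite /preimage /= GK.
  exists setT; split=> //; [exact: openT|exact: smooth_on_id|].
  move=> Z cZ _; have SZ := embedded_chart_sub (CS Cc) cZ.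
  split=> /=; last by rewrite GK.
  by split; [exact: GX|rewrite /preimage /= GK].
split; first exact: FS.
have [c Cc cY] := C_cover (FS Xx).
exists (pullback_chart c), c, id; split; [by exists c|exact: CS|].
split=> //; exists setT; split=> //; [exact: openT|exact: smooth_on_id|].
by move=> y [].
Qed.

End PullbackAtlas.

(** * Polar decomposition *)

Lemma poly_interpolation (F : fieldType) (f : F -> F) (s : seq F) :
  exists p : {poly F}, {in s, forall x, p.[x] = f x}.
Proof.
elim: s => [|a s [p ps]]; first by exists 0.
have [as_|nas] := boolP (a \in s).
  by exists p => x; rewrite inE => /predU1P[->|]; exact: ps.
pose q := \prod_(b <- s) ('X - b%:P).
have qa : q.[a] != 0.
  by have := root_prod_XsubC s a; rewrite (negbTE nas) /root => ->.
exists (p + ((f a - p.[a]) / q.[a]) *: q) => x.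
rewrite !hornerE inE => /predU1P[->|xs]; first by rewrite divfK // subrKC.
have /rootP -> : root q x by rewrite root_prod_XsubC.
by rewrite mulr0 addr0 ps.
Qed.

(** The root is a polynomial in [W^T *m W], interpolating the square root on its
    spectrum: this makes it symmetric and lets it commute with whatever commutes with
    [W^T *m W]. *)
Lemma psd_square_root (R : realType) n (W : 'M[R]_n) :
  exists P : 'M[R]_n, [/\ P^T = P, P *m P = W^T *m W &
    forall A, A *m (W^T *m W) = W^T *m W *m A -> A *m P = P *m A].
Proof.
case: n W => [|n] W.
  by exists 0; split=> [||A _]; apply/matrixP => -[].
pose toC := real_complex R.
set T := W^T *m W.
pose TC := map_mx toC T.
have WCt : (map_mx toC W)^t* = map_mx toC W^T.
  by apply/matrixP => i j; rewrite !mxE; exact: conjc_real.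
have TCE : TC = (map_mx toC W)^t* *m map_mx toC W by rewrite WCt -map_mxM.
have TCn : TC \is normalmx.
  apply/normalmxP; suff -> : TC^t* = TC by [].
  by rewrite TCE trmx_mul map_mxM trmxCK.
have /orthomx_spectralP := TCn.
set U := spectralmx TC; set D := spectral_diag TC => TCD.
have Uu : U \is unitarymx := spectral_unitarymx TC.
have UU := unitarymx_unit Uu.
(* The i-th eigenvalue is the squared norm of the i-th column of W U^-1. *)
have Dge0 i : 0 <= D 0 i.
  have -> : D 0 i = ((map_mx toC W *m U^t*)^t* *m (map_mx toC W *m U^t*)) i i.
    rewrite trmx_mul map_mxM trmxCK !mulmxA -[U *m _ *m _]mulmxA -TCE TCD.
    rewrite -invmx_unitary // !mulmxA mulmxV // mul1mx mulmxK //.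
    by rewrite mxE eqxx mulr1n.
  rewrite mxE; apply: sumr_ge0 => j _; rewrite mxE mxE mulrC.
  exact: mul_conjC_ge0.
pose l i : R := complex.Re (D 0 i).
have DE i : D 0 i = toC (l i).
  have := Dge0 i; rewrite lecE /= => /andP[/eqP Im0 _].
  by rewrite /l /toC; case: (D 0 i) Im0 => a b /= ->.
have l0 i : 0 <= l i by have := Dge0 i; rewrite DE lecR.
have [p pl] := poly_interpolation Num.sqrt [seq l i | i : 'I_n.+1].
have pE i : p.[l i] ^+ 2 = l i.
  by rewrite pl ?sqr_sqrtr //; apply/mapP; exists i; rewrite ?mem_enum.
exists (horner_mx T p); split.
- rewrite -[p]coefK poly_def !raddf_sum /=; apply: eq_bigr => i _.
  rewrite linearZ /= linearZ rmorphXn /= horner_mx_X; congr (_ *: _).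
  elim: (val i) => [|k IH]; first by rewrite !expr0 trmx1.
  have TT : T^T = T by rewrite /T trmx_mul trmxK.
  by rewrite exprSr trmx_mul IH TT -[RHS]exprSr exprS.
- rewrite -[_ *m _]/(horner_mx T p * horner_mx T p) -rmorphM -expr2.
  have toC_inj : injective (map_mx toC : 'M[R]_n.+1 -> _) by apply: map_mx_inj.
  apply: toC_inj; rewrite map_horner_mx -/TC [in LHS]TCD horner_mx_uconjC //.
  rewrite horner_mx_diag [RHS]TCD; congr (_ *m diag_mx _ *m _).
  apply/rowP => i; rewrite mxE DE horner_map /=; congr (toC _).
  by rewrite hornerE.
- move=> A AT; exact: comm_mx_horner.
Qed.

(** The orthogonal factor of the polar decomposition of an intertwiner between orthogonal
    matrices still intertwines them, because [W^T *m W] commutes with [A]. *)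
Lemma orthogonal_similar (R : realType) n (A B W : 'M[R]_n) :
  On R n A -> On R n B -> W \in unitmx -> W *m A = B *m W ->
  exists2 X, On R n X & X *m A = B *m X.
Proof.
move=> Ao Bo Wu WA.
have [P [PT PP Pcomm]] := psd_square_root W.
have Pu : P \in unitmx.
  suff : P *m P \in unitmx by rewrite unitmx_mul => /andP[].
  by rewrite PP unitmx_mul unitmx_tr Wu.
have WtB : W^T *m B = A *m W^T.
  have /(congr1 trmx) := WA; rewrite !trmx_mul => AW.
  have := congr1 (fun Z => A *m Z *m B) AW.
  by rewrite /= !mulmxA Ao mul1mx -[_ *m B^T *m B]mulmxA On_trmulmx // mulmx1.
have AP : A *m P = P *m A.
  by apply: Pcomm; rewrite mulmxA -WtB -!mulmxA WA.
have AiP : invmx P *m A = A *m invmx P.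
  apply: (can_inj (mulmxK Pu)); rewrite mulmxKV // -mulmxA AP mulKmx //.
have oX : On R n (W *m invmx P).
  apply/mulmx1C; rewrite trmx_mul trmx_inv PT -!mulmxA [W^T *m _]mulmxA -PP.
  by rewrite -mulmxA mulmxV // mulmx1 mulVmx.
exists (W *m invmx P) => //.
by rewrite -mulmxA AiP !mulmxA WA.
Qed.

(** * Orthogonal centralizers *)

Section OrthogonalGroups.
Variables (R : realType) (n : nat).
Implicit Types X Y g A : 'M[R]_n.

Lemma On1 : On R n 1%:M.
Proof. by rewrite /On /= trmx1 mulmx1. Qed.

Lemma OnM X Y : On R n X -> On R n Y -> On R n (X *m Y).
Proof.
rewrite /On /= => Xo Yo.
by rewrite trmx_mul mulmxA -[X *m Y *m _]mulmxA Yo mulmx1.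
Qed.

Lemma OnT X : On R n X -> On R n X^T.
Proof. by move=> /On_trmulmx; rewrite /On /= trmxK. Qed.

Lemma On_unit X : On R n X -> X \in unitmx.
Proof. by move=> /mulmx1_unit []. Qed.

Definition comm_On (A : 'M[R]_n) : set 'M[R]_n := centralizer A `&` On R n.

Lemma comm_OnP A X : comm_On A X <-> On R n X /\ A *m X = X *m A.
Proof.
split=> [[[_ AX] Xo]//|[Xo AX]]; split=> //; split=> //; exact: On_unit.
Qed.

Lemma comm_On1 A : comm_On A 1%:M.
Proof. by apply/comm_OnP; rewrite mulmx1 mul1mx; split=> //; exact: On1. Qed.

Lemma comm_OnM A X Y : comm_On A X -> comm_On A Y -> comm_On A (X *m Y).
Proof.
move=> /comm_OnP [Xo AX] /comm_OnP [Yo AY]; apply/comm_OnP; split; first exact: OnM.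
by rewrite mulmxA AX -mulmxA AY mulmxA.
Qed.

Lemma comm_OnT A X : comm_On A X -> comm_On A X^T.
Proof.
move=> /comm_OnP [Xo AX]; apply/comm_OnP; split; first exact: OnT.
have := congr1 (fun Z => X^T *m Z *m X^T) AX.
by rewrite /= !mulmxA On_trmulmx // mul1mx -!mulmxA Xo mulmx1.
Qed.

(** For [e = 1] this parametrizes the Lie algebra of the orthogonal centralizer of [A], and
    for [e = -1] and [A] orthogonal, the model space of the charts of the orbit of [A]. *)
Lemma skew_param A (e : R) :
  exists d (emb : {linear 'rV[R]_d -> 'M[R]_n}) (coord : {linear 'M[R]_n -> 'rV[R]_d}),
    [/\ forall v, so R n (emb v) /\ emb v *m A = e *: (A *m emb v),
        cancel emb coord &
        forall K, so R n K -> K *m A = e *: (A *m K) -> emb (coord K) = K].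
Proof.
pose f : {linear 'M[R]_n -> 'M[R]_n} := (@trmx R n n \+ idfun)%R.
pose g : {linear 'M[R]_n -> 'M[R]_n} := (mulmxr A \- (e \*: mulmx A))%R.
have [d [emb [coord [fg embK coordK]]]] := linear_subspace_param f g.
exists d, emb, coord; split=> // [v|K Ks KA].
  have [/= /eqP fv /eqP gv] := fg v; split; last by apply/eqP; rewrite -subr_eq0.
  by apply/eqP; rewrite -addr_eq0.
apply: coordK; rewrite /f /g /=; first by rewrite Ks addNr.
by rewrite KA subrr.
Qed.

Lemma unitmx_1D1 : 1%:M + 1%:M \in @unitmx R n.
Proof. by rewrite -mulr2n -scaler_nat unitmxZ ?unitmx1 // unitfE pnatr_eq0. Qed.

Section CentralizerCharts.
Variables (A : 'M[R]_n) (d : nat).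
Variables (emb : {linear 'rV[R]_d -> 'M[R]_n}) (coord : {linear 'M[R]_n -> 'rV[R]_d}).
Hypothesis emb_in : forall v, so R n (emb v) /\ emb v *m A = 1 *: (A *m emb v).
Hypothesis embK : cancel emb coord.
Hypothesis coordK : forall K, so R n K -> K *m A = 1 *: (A *m K) -> emb (coord K) = K.

Lemma comm_On_adapted g : comm_On A g -> cayley_adapted emb coord (comm_On A) g^T 1%:M.
Proof.
move=> Gg; have /comm_OnP [og Ag] := Gg.
split; [exact: OnT|exact: On1| |].
  move=> v; rewrite /cayley_param trmxK trmx1 mulmx1.
  apply: comm_OnM => //; have [Ks KA] := emb_in v.
  apply/comm_OnP; split; first exact: cayley_orthogonal.
  by apply: cayley_intertwine; rewrite ?unitmx_1Dskew // KA scale1r.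
move=> Y GY; rewrite mulmx1 => u1.
have /comm_OnP [oX AX] := comm_OnM (comm_OnT Gg) GY.
apply: coordK; first exact: cayley_skew.
by rewrite scale1r; apply/esym/cayley_intertwine.
Qed.

End CentralizerCharts.

(** Left translates of one Cayley chart cover the group. *)
Lemma comm_On_manifold A : exists d, embedded_manifold (comm_On A) d.
Proof.
have [d [emb [coord [emb_in embK coordK]]]] := skew_param A 1.
exists d => g Gg.
exists (cayley_chart coord (comm_On A) g^T 1%:M).
  apply: (cayley_chart_embedded (fun v => (emb_in v).1) embK).
  exact: comm_On_adapted.
have /comm_OnP [og _] := Gg.
by split=> //=; rewrite mulmx1 On_trmulmx // unitmx_1D1.
Qed.

(** The orthogonal group is the orthogonal centralizer of the identity. *)
Lemma On_manifold : exists d, embedded_manifold (On R n) d.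
Proof.
have [d md] := comm_On_manifold 1%:M; exists d.
suff -> : On R n = comm_On 1%:M by [].
apply/seteqP; split=> X; last by case.
by move=> Xo; apply/comm_OnP; rewrite mulmx1 mul1mx.
Qed.

Lemma closed_eq_continuous (F : normedModType R) (f h : 'M[R]_n -> F) :
  smooth_on setT f -> smooth_on setT h -> closed [set X | f X = h X].
Proof.
move=> sf sh.
rewrite (_ : [set X | _] = (fun X => f X - h X) @^-1` [set 0]).
  apply: preimage_closed.
    move=> X _.
    have cf : f Y @[Y --> X] --> f X := smooth_on_continuous sf (I : setT X).
    have ch : h Y @[Y --> X] --> h X := smooth_on_continuous sh (I : setT X).
    exact: cvgB cf ch.
  exact/accessible_closed_set1/hausdorff_accessible/norm_hausdorff.
apply/seteqP; split=> X; rewrite /preimage /=.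
  by move=> ->; exact: subrr.
by move=> /eqP; rewrite subr_eq0 => /eqP.
Qed.

(** The analogous fact for row vectors is transported along [vec_mx]. *)
Lemma bounded_closed_mx_compact (A : set 'M[R]_n) :
  bounded_set A -> closed A -> compact A.
Proof.
move=> bA cA.
have -> : A = (@vec_mx R n n) @` ((@vec_mx R n n) @^-1` A).
  apply/seteqP; split=> [X AX|_ [v Av <-]//].
  by exists (mxvec X); rewrite /preimage /= mxvecK.
have cv : continuous (@vec_mx R n n) by exact: continuous_linear_mx.
apply: continuous_compact.
  by apply: continuous_subspaceT.
apply: bounded_closed_compact; last by apply: preimage_closed => // X _; exact: cv.
have [M [Mr MA]] := bA; exists M; split=> // M' MM' v /= Av.
apply: le_trans (MA _ MM' _ Av).
rewrite /Num.Def.normr /= !mx_normrE; apply/bigmax_leP; split.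
  by apply/bigmax_geP; left.
move=> [i ij] _ /=; rewrite ord1; case/mxvec_indexP: ij => a b.
apply/bigmax_geP; right; exists (a, b) => //=.
by rewrite -[in leLHS](vec_mxK v) mxvecE.
Qed.

Lemma comm_On_compact A : compact (comm_On A).
Proof.
apply: bounded_closed_mx_compact.
  exists 1; split=> // M M1 X [_ Xo] /=.
  rewrite /Num.Def.normr /= mx_normrE; apply/bigmax_leP.
  split; first exact/ltW/(lt_trans _ M1).
  move=> [i j] _ /=; apply: le_trans (ltW M1).
  have /matrixP /(_ i i) := Xo; rewrite !mxE eqxx => XX.
  rewrite -(@ler_sqr _ _ 1) ?nnegrE // expr1n -[1]/(true%:R) -XX (bigD1 j) //= mxE.
  rewrite real_normK ?num_real // -expr2 lerDl.
  by apply: sumr_ge0 => l _; rewrite mxE -expr2 sqr_ge0.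
have oT := @openT 'M[R]_n.
have sid := @smooth_on_id R 'M[R]_n setT.
have -> : comm_On A = [set X | X *m X^T = 1%:M] `&` [set X | A *m X = X *m A].
  by apply/seteqP; split=> X; [move=> /comm_OnP|move=> ?; apply/comm_OnP].
apply: closedI; apply: closed_eq_continuous.
- by apply: smooth_on_mulmx => //; exact: (smooth_on_linear_mx (@trmx R n n) oT sid).
- exact: smooth_on_cst.
- by apply: smooth_on_mulmx => //; exact: smooth_on_cst.
- by apply: smooth_on_mulmx => //; exact: smooth_on_cst.
Qed.

End OrthogonalGroups.

(** * The orbit of an orthogonal matrix under the centralizer of its square *)

Section OrthogonalCancel.
Variables (R : realType) (n m : nat) (X : 'M[R]_n).
Hypothesis oX : On R n X.

Lemma OnTK (Y : 'M[R]_(n, m)) : X^T *m (X *m Y) = Y.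
Proof. by rewrite mulmxA On_trmulmx // mul1mx. Qed.

Lemma OnKT (Y : 'M[R]_(n, m)) : X *m (X^T *m Y) = Y.
Proof. by rewrite mulmxA [X *m _]oX mul1mx. Qed.

Lemma mulOnTK (Y : 'M[R]_(m, n)) : Y *m X^T *m X = Y.
Proof. by rewrite -mulmxA On_trmulmx // mulmx1. Qed.

Lemma mulOnKT (Y : 'M[R]_(m, n)) : Y *m X *m X^T = Y.
Proof. by rewrite -mulmxA [X *m _]oX mulmx1. Qed.

End OrthogonalCancel.

Section Orbit.
Variables (R : realType) (n : nat) (A C : 'M[R]_n).
Hypotheses (oA : On R n A) (oC : On R n C).
Implicit Types X Y g : 'M[R]_n.

Let G := comm_On (A *m A).
Let H := comm_On A.

Definition orbit_map g : 'M[R]_n := C *m g *m A *m g^T *m C^T.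
Let S := orbit_map @` G.

(** Hence the stabilizer of [A] under conjugation by the group [G] is all of [H]. *)
Lemma comm_On_sub_square : H `<=` G.
Proof.
move=> X /comm_OnP [oX AX]; apply/comm_OnP; split=> //.
by rewrite -mulmxA AX !mulmxA AX.
Qed.

Lemma orbit_map_stab g x : H x -> orbit_map (g *m x) = orbit_map g.
Proof.
move=> /comm_OnP [ox Ax]; rewrite /orbit_map trmx_mul !mulmxA.
rewrite -[C *m g *m x *m A]mulmxA -Ax mulmxA -[_ *m x *m x^T]mulmxA.
by rewrite [x *m x^T]ox mulmx1.
Qed.

Lemma orbit_map_eq g g' : G g -> G g' -> orbit_map g = orbit_map g' -> H (g^T *m g').
Proof.
move=> /comm_OnP [og _] /comm_OnP [og' _] e.
apply/comm_OnP; split; first by apply: OnM => //; exact: OnT.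
have {}e : g *m A *m g^T = g' *m A *m g'^T.
  have := congr1 (fun Z => C^T *m Z *m C) e.
  by rewrite /orbit_map /= -!mulmxA !OnTK // On_trmulmx // !mulmx1.
have := congr1 (fun Z => g^T *m Z *m g') e.
by rewrite /= -!mulmxA OnTK // On_trmulmx // mulmx1.
Qed.

Lemma orbit_conj g g' : (C *m g)^T *m orbit_map g' *m (C *m g *m A^T) =
  (g^T *m g') *m A *m (g^T *m g')^T *m A^T.
Proof.
by rewrite /orbit_map !trmx_mul trmxK -!mulmxA !OnTK.
Qed.

Lemma orbit_square g : G g -> orbit_map g *m orbit_map g = C *m (A *m A) *m C^T.
Proof.
move=> /comm_OnP [og Ag].
rewrite /orbit_map -!mulmxA OnTK // OnTK //; congr (_ *m _).
by rewrite ![A *m (A *m _)]mulmxA ![g *m (A *m A *m _)]mulmxA -Ag -!mulmxA OnKT.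
Qed.

Lemma On_orbit_map g : G g -> On R n (orbit_map g).
Proof.
move=> /comm_OnP [og _].
by do ![apply: OnM => //]; exact: OnT.
Qed.

Section OrbitCharts.
Variable d : nat.
Variables (emb : {linear 'rV[R]_d -> 'M[R]_n}) (coord : {linear 'M[R]_n -> 'rV[R]_d}).
Hypothesis emb_in : forall v, so R n (emb v) /\ emb v *m A = -1 *: (A *m emb v).
Hypothesis embK : cancel emb coord.
Hypothesis coordK : forall K, so R n K -> K *m A = -1 *: (A *m K) -> emb (coord K) = K.

(** Conjugation by [A] inverts the Cayley transform of anything anticommuting with [A]. *)
Lemma cayley_anticomm K : so R n K -> K *m A = -1 *: (A *m K) ->
  A *m cayley K = (cayley K)^T *m A.
Proof.
move=> Ks KA; rewrite tr_cayley; apply: cayley_intertwine.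
- exact: unitmx_1Dskew.
- by rewrite -unitmx_tr linearD /= trmxK trmx1 unitmx_1Dskew.
- by rewrite Ks mulNmx KA scaleN1r opprK.
Qed.

(** [B = cayley K *m A] is another square root of [A *m A], and then
    (A + B) A = B (A + B).  Since A + B = (1 + cayley K) A is invertible, [A] and [B] are
    similar; a similarity between square roots of [A *m A] commutes with [A *m A]. *)
Lemma orbit_of_anticomm K : so R n K -> K *m A = -1 *: (A *m K) ->
  exists2 X, G X & X *m A *m X^T = cayley K *m A.
Proof.
move=> Ks KA; pose B := cayley K *m A.
have oK : On R n (cayley K) := cayley_orthogonal Ks.
have oB : On R n B by apply: OnM.
have BB : B *m B = A *m A.
  by rewrite /B -mulmxA [A *m (_ *m _)]mulmxA cayley_anticomm // -mulmxA OnKT.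
have Wu : A + B \in unitmx.
  have -> : A + B = (1%:M + cayley K) *m A by rewrite mulmxDl mul1mx.
  by rewrite unitmx_mul (On_unit oA) andbT unitmx_cayley1D // unitmx_1Dskew.
have WA : (A + B) *m A = B *m (A + B) by rewrite mulmxDl mulmxDr BB addrC.
have [X oX XA] := orthogonal_similar oA oB Wu WA.
exists X; last by rewrite XA mulOnKT.
by apply/comm_OnP; split=> //; rewrite [RHS]mulmxA XA -[RHS]mulmxA XA mulmxA BB.
Qed.

(** For a point of the orbit, brought back to a square root B of [A *m A], the matrix
    Z = B A^T satisfies A Z^T = B = Z A, so that its Cayley transform, being skew,
    anticommutes with [A]; [orbit_of_anticomm] is the converse. *)
Lemma orbit_adapted g : G g ->
  cayley_adapted emb coord S (C *m g)^T (C *m g *m A^T).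
Proof.
move=> Gg; have /comm_OnP [og _] := Gg.
split.
- by apply: OnT; apply: OnM.
- by apply: OnM; [apply: OnM|apply: OnT].
- move=> v; have [Ks KA] := emb_in v.
  have [X GX XA] := orbit_of_anticomm Ks KA.
  exists (g *m X); first exact: comm_OnM.
  rewrite /cayley_param /orbit_map !trmx_mul !trmxK -!mulmxA.
  by rewrite [cayley _ *m (A *m _)]mulmxA -XA -!mulmxA.
move=> _ [g' Gg' <-]; rewrite orbit_conj => u1.
have /comm_OnP [] := comm_OnM (comm_OnT Gg) Gg'; move: (g^T *m g') u1 => l u1 ol Al.
set B := l *m A *m l^T in u1 *.
have oB : On R n B by apply: OnM; [apply: OnM|apply: OnT].
have BB : B *m B = A *m A.
  rewrite /B -!mulmxA OnTK // ![A *m (A *m _)]mulmxA mulmxA -Al.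
  by rewrite mulOnKT.
have oZ : On R n (B *m A^T) by apply: OnM => //; apply: OnT.
have Zs := cayley_skew oZ u1.
apply: coordK => //.
have : A *m cayley (B *m A^T)^T = cayley (B *m A^T) *m A.
  apply: cayley_intertwine => //.
    by rewrite -unitmx_tr linearD /= trmxK trmx1.
  by rewrite trmx_mul trmxK mulOnTK // mulmxA -BB mulOnKT.
by rewrite -tr_cayley Zs mulmxN scaleN1r => <-.
Qed.

Definition orbit_charts : set (@chart R 'M[R]_n d) :=
  [set cayley_chart coord S (C *m g)^T (C *m g *m A^T) | g in G].

Lemma orbit_charts_embedded : orbit_charts `<=` embedded_atlas S d.
Proof.
move=> _ [g Gg <-]; apply: (cayley_chart_embedded (fun v => (emb_in v).1) embK).
exact: orbit_adapted.
Qed.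

Lemma orbit_chart_center g : G g ->
  (cayley_chart coord S (C *m g)^T (C *m g *m A^T)).1 (orbit_map g).
Proof.
move=> Gg; have /comm_OnP [og _] := Gg.
split; first by exists g.
by rewrite orbit_conj On_trmulmx // mul1mx trmx1 mulmx1 [A *m _]oA unitmx_1D1.
Qed.

Lemma orbit_charts_cover Y : S Y -> exists2 c, orbit_charts c & c.1 Y.
Proof.
move=> [g Gg <-]; exists (cayley_chart coord S (C *m g)^T (C *m g *m A^T)).
  by exists g.
exact: orbit_chart_center.
Qed.

(** The value does not depend on the representative, by [orbit_map_stab]. *)
Definition quotient_to_orbit (D : set 'M[R]_n) : 'M[R]_n := orbit_map (get D).
Definition orbit_to_quotient (Y : 'M[R]_n) : set 'M[R]_n :=
  [set g | G g /\ orbit_map g = Y].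

Lemma quotient_to_orbitE g : quotient_to_orbit (coset_map H g) = orbit_map g.
Proof.
rewrite /quotient_to_orbit; have [|x Hx <-] := @getPex _ (coset_map H g).
  by exists g; exists 1%:M; [exact: comm_On1|rewrite mulmx1].
exact: orbit_map_stab.
Qed.

Lemma orbit_to_quotientE g : G g -> orbit_to_quotient (orbit_map g) = coset_map H g.
Proof.
move=> Gg; have /comm_OnP [og _] := Gg.
apply/seteqP; split=> [g' [Gg' e]|_ [x Hx <-]].
  exists (g^T *m g'); last by rewrite OnKT.
  exact: orbit_map_eq.
split; last exact: orbit_map_stab.
by apply: comm_OnM => //; exact: comm_On_sub_square.
Qed.

Definition quotient_charts :=
  pullback_chart (quotient_set G H) quotient_to_orbit @` orbit_charts.

Lemma quotient_to_orbit_in D : quotient_set G H D -> S (quotient_to_orbit D).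
Proof. by move=> [g Gg <-]; rewrite quotient_to_orbitE; exists g. Qed.

Lemma orbit_to_quotient_in Y : S Y -> quotient_set G H (orbit_to_quotient Y).
Proof. by move=> [g Gg <-]; rewrite orbit_to_quotientE //; exists g. Qed.

Lemma quotient_to_orbitK D : quotient_set G H D ->
  orbit_to_quotient (quotient_to_orbit D) = D.
Proof. by move=> [g Gg <-]; rewrite quotient_to_orbitE orbit_to_quotientE. Qed.

Lemma orbit_to_quotientK Y : S Y -> quotient_to_orbit (orbit_to_quotient Y) = Y.
Proof. by move=> [g Gg <-]; rewrite orbit_to_quotientE // quotient_to_orbitE. Qed.

Lemma quotient_smooth_atlas : smooth_atlas (quotient_set G H) quotient_charts.
Proof.
apply: (smooth_atlas_pullback quotient_to_orbit_in orbit_to_quotient_in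
  quotient_to_orbitK orbit_to_quotientK orbit_charts_embedded orbit_charts_cover).
move=> _ _ [g Gg <-] [g' Gg' <-].
apply: (cayley_chart_transition (fun v => (emb_in v).1) embK); exact: orbit_adapted.
Qed.

Lemma orbit_diffeomorphic_quotient :
  diffeomorphic S (embedded_atlas S d) (quotient_set G H) quotient_charts.
Proof.
exact: (diffeomorphic_pullback quotient_to_orbit_in orbit_to_quotient_in
  quotient_to_orbitK orbit_to_quotientK orbit_charts_embedded orbit_charts_cover).
Qed.

End OrbitCharts.

Lemma smooth_orbit_map (E : normedModType R) O (f : E -> 'M[R]_n) :
  open O -> smooth_on O f -> smooth_on O (fun x => orbit_map (f x)).
Proof.
move=> oO sf; rewrite /orbit_map.
apply: smooth_on_mulmx => //; last exact: smooth_on_cst.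
apply: smooth_on_mulmx => //; last exact: (smooth_on_linear_mx (@trmx R n n) oO sf).
apply: smooth_on_mulmx => //; last exact: smooth_on_cst.
apply: smooth_on_mulmx => //; exact: smooth_on_cst.
Qed.

Lemma orbit_compact : compact S.
Proof.
apply: continuous_compact; last exact: comm_On_compact.
apply: continuous_subspaceT => X.
have oT := @openT 'M[R]_n.
apply: (@smooth_on_continuous _ _ _ setT) => //.
by apply: smooth_orbit_map => //; exact: smooth_on_id.
Qed.

End Orbit.

(** * The projection onto the coset space *)

Section Submersion.
Variables (R : realType) (n : nat) (A C : 'M[R]_n).
Hypotheses (oA : On R n A) (oC : On R n C).
Let G := comm_On (A *m A).
Let H := comm_On A.
Let S := orbit_map A C @` G.

Section Charts.
Variable d : nat.
Variables (emb : {linear 'rV[R]_d -> 'M[R]_n}) (coord : {linear 'M[R]_n -> 'rV[R]_d}).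
Hypothesis emb_in : forall v, so R n (emb v) /\ emb v *m A = -1 *: (A *m emb v).
Hypothesis embK : cancel emb coord.
Variable e : nat.
Variables (emb' : {linear 'rV[R]_e -> 'M[R]_n}) (coord' : {linear 'M[R]_n -> 'rV[R]_e}).
Hypothesis emb'_in : forall v,
  so R n (emb' v) /\ emb' v *m (A *m A) = 1 *: (A *m A *m emb' v).
Hypothesis emb'K : cancel emb' coord'.
Hypothesis coord'K : forall K, so R n K -> K *m (A *m A) = 1 *: (A *m A *m K) ->
  emb' (coord' K) = K.

(** The projection [g' |-> g' H], read in the Cayley charts centred at [g] and at its
    coset. *)
Definition orbit_rep (g : 'M[R]_n) (v : 'rV[R]_e) : 'rV[R]_d :=
  (cayley_chart coord S (C *m g)^T (C *m g *m A^T)).2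
    (orbit_map A C (cayley_param emb' g^T 1%:M v)).

Let orbit_rep_dom (g : 'M[R]_n) : set 'rV[R]_e :=
  setT `&` [set v | 1%:M + (C *m g)^T *m orbit_map A C (cayley_param emb' g^T 1%:M v)
                    *m (C *m g *m A^T) \in unitmx].

Lemma smooth_orbit_rep g :
  open (orbit_rep_dom g) /\ smooth_on (orbit_rep_dom g) (orbit_rep g).
Proof.
apply: (smooth_cayley_chart coord S) => //; first exact: openT.
apply: smooth_orbit_map; first exact: openT.
exact: (smooth_cayley_param (fun v => (emb'_in v).1)).
Qed.

(** In a direction [K] anticommuting with [A], conjugating [A] by [cayley (t *: K)] amounts
    to multiplying it by the square of [cayley (t *: K)]. *)
Lemma orbit_rep_direction g K (t : R) : G g -> so R n K -> K *m A = -1 *: (A *m K) ->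
  1%:M + (t *: K) *m (t *: K) \in unitmx ->
  orbit_rep g (t *: coord' K) =
    t *: coord (2 *: (K *m invmx (1%:M + (t *: K) *m (t *: K)))).
Proof.
move=> Gg Ks KA tu; have /comm_OnP [og _] := Gg.
have KAA : K *m (A *m A) = 1 *: (A *m A *m K).
  rewrite scale1r mulmxA KA -scalemxAl -mulmxA KA -scalemxAr scalerA.
  by rewrite mulrNN mulr1 scale1r mulmxA.
have tKs : so R n (t *: K) by rewrite /so /= linearZ /= Ks scalerN.
have tKA : (t *: K) *m A = -1 *: (A *m (t *: K)).
  by rewrite -scalemxAl KA -scalemxAr !scalerA mulrC.
have -> : t *: coord (2 *: (K *m invmx (1%:M + t *: K *m (t *: K)))) =
    coord (cayley (cayley (t *: K) *m cayley (t *: K))).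
  rewrite cayley_square // ?(unitmx_1Dskew tKs) //.
  move: (invmx _) => I; have -> : 2 *: (t *: K *m I) = t *: (2 *: (K *m I)).
    by rewrite -scalemxAl !scalerA mulrC.
  by rewrite [RHS]linearZ.
rewrite /orbit_rep /=; congr (coord (cayley _)).
rewrite orbit_conj // /cayley_param trmxK trmx1 mulmx1 OnTK //.
rewrite linearZ /= coord'K //.
have oc : On R n (cayley (t *: K)) := cayley_orthogonal tKs.
have Ac : A *m (cayley (t *: K))^T = cayley (t *: K) *m A.
  have := congr1 (mulmx (cayley (t *: K))) (cayley_anticomm tKs tKA).
  by rewrite OnKT // => cAc; rewrite -{1}cAc mulmxA mulOnKT.
by rewrite -[_ *m A *m _]mulmxA Ac mulmxA mulOnKT.
Qed.

(** Along a direction [K] anticommuting with [A] the projection is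
    t |-> 2 t K (1 + t^2 K^2)^-1, of derivative 2 K at 0, and such [K] form the model
    space of the charts of the orbit. *)
Lemma diff_orbit_rep g : G g -> forall w, exists v, 'd (orbit_rep g) 0 v = w.
Proof.
move=> Gg w; pose K := emb w.
have [Ks KA] := emb_in w; rewrite -/K in Ks KA.
pose v := coord' K.
have [oD sD] := smooth_orbit_rep g.
have D0 : orbit_rep_dom g 0.
  split=> //=; have /comm_OnP [og _] := Gg.
  rewrite orbit_conj // /cayley_param trmxK trmx1 mulmx1 OnTK //.
  by rewrite linear0 cayley0 mul1mx trmx1 mulmx1 [A *m _]oA unitmx_1D1.
have df : differentiable (orbit_rep g) 0 := smooth_on_differentiable sD D0.
(* The factor 1/2 compensates the doubling of the angle. *)
exists (2^-1 *: v); rewrite linearZ /=.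
have <- : 'D_v (orbit_rep g) 0 = 'd (orbit_rep g) 0 v by rewrite deriveE.
suff -> : 'D_v (orbit_rep g) 0 = 2 *: w by rewrite scalerA mulVf ?pnatr_eq0 ?scale1r.
pose q (t : R) : 'M[R]_n := 1%:M + (t *: K) *m (t *: K).
pose k (t : R) : 'rV[R]_d := coord (2 *: (K *m invmx (q t))).
have oT := @openT R.
have sq : smooth_on setT q.
  have sK : smooth_on setT (fun t : R => t *: K).
    by move=> p; apply: Ck_onZl => //; exact: smooth_on_id.
  apply: smooth_onD => //; first exact: smooth_on_cst.
  exact: smooth_on_mulmx.
have oU := open_unitmx_preimage oT sq; set U := _ `&` _ in oU.
have U0 : U 0 by split=> //=; rewrite /q scale0r mul0mx addr0 unitmx1.
have sk : smooth_on U k.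
  apply: smooth_on_linear_mx => //.
  apply: (smooth_on_linear_mx ( *:%R 2 : {linear 'M[R]_n -> 'M[R]_n})) => //.
  apply: smooth_on_mulmx => //; first exact: smooth_on_cst.
  apply: smooth_on_invmx => // [t []//|].
  by apply: smooth_on_subset sq.
have k0 : k 0 = 2 *: w.
  by rewrite /k /q scale0r mul0mx addr0 invmx1 mulmx1 linearZ /= embK.
have ck : k t @[t --> (0 : R)] --> k 0 := smooth_on_continuous sk U0.
rewrite -k0 /derive; apply: cvg_lim => //.
apply: cvg_trans (cvg_trans (cvg_app _ (cvg_within _)) ck).
apply: near_eq_cvg.
have nU : \forall t \near (0 : R)^', U t.
  by apply: cvg_within; apply: open_nbhs_nbhs.
have rep0 : orbit_rep g 0 = 0.
  have := @orbit_rep_direction g K 0 Gg Ks KA; rewrite !scale0r mul0mx addr0.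
  by apply; exact: unitmx1.
near=> t.
have t0 : t != 0 by near: t; exact: nbhs_dnbhs_neq.
have Ut : U t by near: t.
rewrite /= addr0 rep0 subr0 (orbit_rep_direction Gg Ks KA Ut.2).
by rewrite scalerA mulVf // scale1r.
Unshelve. all: by end_near. Qed.

Lemma coset_map_submersion :
  submersion G (embedded_atlas G e) (quotient_set G H) (quotient_charts A C coord)
    (coset_map H).
Proof.
move=> g Gg; split; first by exists g.
have GA := comm_On_adapted emb'_in coord'K.
exists (cayley_chart coord' G g^T 1%:M).
pose cS := cayley_chart coord S (C *m g)^T (C *m g *m A^T).
exists (pullback_chart (quotient_set G H) (quotient_to_orbit A C) cS).
exists (orbit_rep g).
have og : On R n g by have /comm_OnP [] := Gg.
have cg : (cayley_chart coord' G g^T 1%:M).2 g = 0.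
  by rewrite /= mulmx1 On_trmulmx // cayley1 linear0.
split; last by rewrite cg; exact: diff_orbit_rep.
- apply: (cayley_chart_embedded (fun v => (emb'_in v).1) emb'K); exact: GA.
- by exists cS => //; exists g.
have [oD sD] := smooth_orbit_rep g.
split.
- by split=> //=; rewrite mulmx1 On_trmulmx // unitmx_1D1.
- split; first by exists g.
  rewrite /preimage /= quotient_to_orbitE. by have := orbit_chart_center oA oC coord Gg.
exists (orbit_rep_dom g); split=> //.
  rewrite cg; split=> //=.
  rewrite orbit_conj // /cayley_param trmxK trmx1 mulmx1 OnTK //.
  by rewrite linear0 cayley0 mul1mx trmx1 mulmx1 [A *m _]oA unitmx_1D1.
move=> y cy [_ Dy].
have yK := cayley_paramK (GA _ Gg) cy.
move: Dy; rewrite /= yK => Dy.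
split; last by rewrite /orbit_rep /= yK quotient_to_orbitE.
split; first by exists y => //; case: cy.
rewrite /preimage /= quotient_to_orbitE; split=> //.
by exists y => //; case: cy.
Qed.

End Charts.

Theorem orbit_homogeneous :
  compact S /\ exists2 d, submanifold (On R n) S d &
    exists e (At : set (chart (set 'M[R]_n) e)),
      homogeneous_atlas G H At /\
      diffeomorphic S (embedded_atlas S d) (quotient_set G H) At.
Proof.
split; first exact: orbit_compact.
have [d [emb [coord [emb_in embK coordK]]]] := skew_param A (-1).
have [e [emb' [coord' [emb'_in emb'K coord'K]]]] := skew_param (A *m A) 1.
exists d.
  split; [by move=> _ [g Gg <-]; exact: On_orbit_map|exact: On_manifold|].
  move=> Y SY; have [c Cc cY] := orbit_charts_cover oA oC coord SY.
  exists c => //; exact: (orbit_charts_embedded oA oC emb_in embK coordK).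
exists d, (quotient_charts A C coord); split; last first.
  exact: (orbit_diffeomorphic_quotient oA oC emb_in embK coordK).
split; first exact: (quotient_smooth_atlas oA oC emb_in embK coordK).
exists e; split.
  move=> g Gg; exists (cayley_chart coord' G g^T 1%:M).
    apply: (cayley_chart_embedded (fun v => (emb'_in v).1) emb'K).
    exact: (comm_On_adapted emb'_in coord'K).
  have /comm_OnP [og _] := Gg.
  by split=> //=; rewrite mulmx1 On_trmulmx // unitmx_1D1.
by move=> g Gg; exact: (coset_map_submersion emb_in embK emb'_in emb'K coord'K Gg).
Qed.
End Submersion.

(** * Similarity of normal matrices with equal characteristic polynomials *)

Lemma char_poly_similar (F : fieldType) n (A B W : 'M[F]_n) :
  W \in unitmx -> W *m A = B *m W -> char_poly A = char_poly B.
Proof.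
move=> Wu WA.
have WA' : map_mx polyC W *m char_poly_mx A = char_poly_mx B *m map_mx polyC W.
  by rewrite /char_poly_mx mulmxBl mulmxBr -!map_mxM WA scalar_mxC.
have := congr1 determinant WA'; rewrite !det_mulmx mulrC det_map_mx => e.
have detW : (\det W)%:P != 0 by rewrite polyC_eq0 -unitfE -unitmxE.
exact: (mulIf detW).
Qed.

Lemma char_poly_diag (F : comNzRingType) n (d : 'rV[F]_n) :
  char_poly (diag_mx d) = \prod_(i < n) ('X - (d 0 i)%:P).
Proof.
rewrite char_poly_trig ?diag_mx_is_trig //.
by apply: eq_bigr => i _; rewrite mxE eqxx mulr1n.
Qed.

(** By unique factorization the diagonal entries agree up to order. *)
Lemma diag_mx_permuted (F : fieldType) n (d d' : 'rV[F]_n) :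
  \prod_(i < n) ('X - (d 0 i)%:P) = \prod_(i < n) ('X - (d' 0 i)%:P) ->
  exists s : 'S_n, perm_mx s *m diag_mx d' = diag_mx d *m perm_mx s.
Proof.
move=> e.
have : perm_eq [tuple d 0 i | i < n] [tuple d' 0 i | i < n].
  by apply: prod_XsubC_eq; rewrite !big_image.
move=> /tuple_permP [s ds]; exists s.
have dE i : d 0 i = d' 0 (s i).
  have := congr1 (fun t => nth 0 t i) ds.
  by rewrite -!tnth_nth !tnth_mktuple.
apply/matrixP => i j; rewrite -row_permE mul_diag_mx !mxE dE.
by case: eqP => [->|]; rewrite ?mulr1 ?mulr0 ?mulr1n.
Qed.

Lemma normal_unitary_similar (F : numClosedFieldType) n (A B : 'M[F]_n) :
  A \is normalmx -> B \is normalmx -> char_poly A = char_poly B ->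
  exists2 W, W \is unitarymx & W *m A = B *m W.
Proof.
move=> /orthomx_spectralP AE /orthomx_spectralP BE.
set U := spectralmx A in AE; set V := spectralmx B in BE.
have Uu : U \is unitarymx := spectral_unitarymx A.
have Vu : V \is unitarymx := spectral_unitarymx B.
have UU := unitarymx_unit Uu; have VU := unitarymx_unit Vu.
have cA : char_poly A = char_poly (diag_mx (spectral_diag A)).
  apply: (char_poly_similar UU); rewrite {1}AE !mulmxA mulmxV // mul1mx.
  by [].
have cB : char_poly B = char_poly (diag_mx (spectral_diag B)).
  apply: (char_poly_similar VU); rewrite {1}BE !mulmxA mulmxV // mul1mx.
  by [].
rewrite cA cB !char_poly_diag => /esym /diag_mx_permuted [s sE].
have su : perm_mx s \is @unitarymx F n n.
  apply/unitarymxP; rewrite tr_perm_mx map_perm_mx -perm_mxM mulgV perm_mx1.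
  by [].
exists (invmx V *m perm_mx s *m U).
  rewrite invmx_unitary //; apply: mul_unitarymx => //; apply: mul_unitarymx => //.
  by rewrite trmxC_unitary.
rewrite {1}AE {1}BE -!mulmxA (mulKVmx UU) (mulKVmx VU).
by congr (_ *m _); rewrite !mulmxA sE.
Qed.

(** The unitary similarity given by the spectral theorem yields a real one, which the
    polar decomposition makes orthogonal. *)
Lemma orthogonal_similar_char_poly (R : realType) n (A B : 'M[R]_n) :
  On R n A -> On R n B ->
  char_poly (map_mx (real_complex R) A) = char_poly (map_mx (real_complex R) B) ->
  exists2 X, On R n X & X *m A = B *m X.
Proof.
move=> oA oB cAB; pose toC := real_complex R.
have toCt (X : 'M[R]_n) : (map_mx toC X)^t* = map_mx toC X^T.
  by apply/matrixP => i j; rewrite !mxE; exact: conjc_real.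
have normal X : On R n X -> map_mx toC X \is normalmx.
  move=> oX; apply/normalmxP.
  by rewrite toCt -!map_mxM [X *m _]oX On_trmulmx.
have realC (X : 'M[R]_n) : map_mx toC X \is a mxOver Num.real.
  apply/mxOverP => i j; rewrite mxE; apply/CrealP; exact: conjc_real.
have [W Wu WA] := normal_unitary_similar (normal A oA) (normal B oB) cAB.
have WU := unitarymx_unit Wu.
have sim : similar_in unitmx (map_mx toC A) (map_mx toC B).
  by exists W; [exact: WU|exact/(similarP WU)].
have [P /andP[/= Preal PU]] := real_similar sim (realC A) (realC B).
move=> /(similarP PU) PA.
pose Q : 'M[R]_n := map_mx (@complex.Re R) P.
have PQ : P = map_mx toC Q.
  apply/matrixP => i j; rewrite !mxE.
  have := mxOverP Preal i j; rewrite /toC => /CrealP.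
  case: (P i j) => a b /= [/eqP]; rewrite eqNr => /eqP b0.
  by rewrite b0.
have QU : Q \in unitmx by move: PU; rewrite PQ map_unitmx.
apply: (orthogonal_similar oA oB QU).
apply: (map_mx_inj (f := toC)); by rewrite !map_mxM -PQ.
Qed.

(** * Block-diagonal matrices *)

Section BlockDiagonal.
Variables (F : comNzRingType).

Lemma mulmx_mxdiag p (p_ : 'I_p -> nat) (B D : forall i, 'M[F]_(p_ i)) :
  \mxdiag_i B i *m \mxdiag_i D i = \mxdiag_i (B i *m D i).
Proof.
rewrite {2}/mxdiag mul_mxdiag_mxblock; apply: eq_mxblock => i j.
by case: eqVneq => [e|_]; rewrite ?mulmx0 //; case: _ / e; rewrite !conform_mx_id.
Qed.

Lemma char_poly_block (n1 n2 : nat) (B : 'M[F]_n1) (D : 'M[F]_n2) :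
  char_poly (block_mx B 0 0 D) = char_poly B * char_poly D.
Proof.
rewrite /char_poly -(det_ublock _ 0); congr (\det _).
by rewrite /char_poly_mx map_block_mx !map_mx0 scalar_mx_block opp_block_mx
  add_block_mx !oppr0 !addr0.
Qed.

Lemma char_poly_castmx (n n' : nat) (e : n = n') (B : 'M[F]_n) :
  char_poly (castmx (e, e) B) = char_poly B.
Proof. by case: _ / e; rewrite castmx_id. Qed.

Lemma char_poly_mxdiag p (p_ : 'I_p -> nat) (B : forall i, 'M[F]_(p_ i)) :
  char_poly (\mxdiag_i B i) = \prod_i char_poly (B i).
Proof.
elim: p p_ B => [|p IH] p_ B.
  have empty n (M : 'M[F]_n) : n = 0%N -> char_poly M = 1.
    by move=> n0; move: M; rewrite n0 => M; rewrite /char_poly det_mx00.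
  by rewrite [RHS]big_ord0; apply: empty; rewrite big_ord0.
rewrite mxdiag_recl char_poly_castmx char_poly_block big_ord_recl; congr (_ * _).
exact: IH.
Qed.

End BlockDiagonal.

Section DirectSum3.
Variables (R : realType) (p q s : nat).
Implicit Types (A : 'M[R]_p) (B : 'M[R]_q) (C : 'M[R]_s).

Lemma mulmx_dsum3 A B C A' B' C' :
  dsum3 A B C *m dsum3 A' B' C' = dsum3 (A *m A') (B *m B') (C *m C').
Proof.
by rewrite /dsum3 !mulmx_block !(mul0mx, mulmx0, addr0, add0r).
Qed.

Lemma addmx_dsum3 A B C A' B' C' :
  dsum3 A B C + dsum3 A' B' C' = dsum3 (A + A') (B + B') (C + C').
Proof. by rewrite /dsum3 !add_block_mx !addr0. Qed.

Lemma tr_dsum3 A B C : (dsum3 A B C)^T = dsum3 A^T B^T C^T.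
Proof. by rewrite /dsum3 !tr_block_mx !trmx0. Qed.

Lemma dsum3_1 : dsum3 1%:M 1%:M 1%:M = 1%:M :> 'M[R]_(p + q + s).
Proof. by rewrite /dsum3 -!scalar_mx_block. Qed.

Lemma dsum3_congr A B C A' B' C' :
  A = A' -> B = B' -> C = C' -> dsum3 A B C = dsum3 A' B' C'.
Proof. by move=> -> -> ->. Qed.

Lemma dsum3_inj A B C A' B' C' :
  dsum3 A B C = dsum3 A' B' C' -> [/\ A = A', B = B' & C = C'].
Proof. by move=> /eq_block_mx [/eq_block_mx [-> _ _ ->] _ _ ->]. Qed.

Lemma On_dsum3 A B C :
  On R _ (dsum3 A B C) <-> [/\ On R p A, On R q B & On R s C].
Proof.
rewrite /On /= tr_dsum3 mulmx_dsum3 -dsum3_1.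
by split=> [/dsum3_inj []//|[-> -> ->]].
Qed.

Lemma char_poly_dsum3 A B C :
  char_poly (dsum3 A B C) = char_poly A * char_poly B * char_poly C.
Proof. by rewrite /dsum3 !char_poly_block. Qed.

End DirectSum3.

Lemma On_mxdiag (R : realType) p (p_ : 'I_p -> nat) (B : forall i, 'M[R]_(p_ i)) :
  On R _ (\mxdiag_i B i) <-> forall i, On R _ (B i).
Proof.
rewrite /On /= tr_mxdiag mulmx_mxdiag -(mxdiagZ 1).
by rewrite -eq_mxdiagP.
Qed.

(** * Complex matrices as real matrices *)

Section Realify.
Variable (R : realType).
Local Notation C := R[i].

(** The case m = 1 of the embedding of complex matrices. *)
Definition cblock (z : C) : 'M[R]_2 := block2 (complex.Re z) (complex.Im z).

Lemma mx2P (A B : 'M[R]_2) :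
  [/\ A 0 0 = B 0 0, A 0 1 = B 0 1, A 1 0 = B 1 0 & A 1 1 = B 1 1] -> A = B.
Proof.
move=> [e00 e01 e10 e11]; apply/matrixP => i j.
have ord2 (l : 'I_2) : l = 0 \/ l = 1.
  by case: l => [[|[|l]] hl] //; [left|right]; apply: val_inj.
by case: (ord2 i) => ->; case: (ord2 j) => ->.
Qed.

Lemma cblockM z w : cblock (z * w) = cblock z *m cblock w.
Proof.
case: z w => [a b] [c d]; apply: mx2P.
by rewrite !mxE !big_ord_recl !big_ord0 !mxE /=; split; ring.
Qed.

Lemma cblockD z w : cblock (z + w) = cblock z + cblock w.
Proof.
by case: z w => [a b] [c d]; apply: mx2P; rewrite !mxE /=; split; ring.
Qed.

Lemma cblock0 : cblock 0 = 0.
Proof. by apply: mx2P; rewrite !mxE /= oppr0. Qed.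

Lemma cblock1 : cblock 1 = 1%:M.
Proof. by apply: mx2P; rewrite !mxE /= oppr0. Qed.

Lemma tr_cblock z : (cblock z)^T = cblock (Num.conj z).
Proof. by case: z => a b; apply: mx2P; rewrite !mxE /= opprK. Qed.

Lemma cblock_inj : injective cblock.
Proof.
move=> [a b] [c d] /matrixP e.
by have := e 0 0; have := e 1 0; rewrite !mxE /= => -> ->.
Qed.

Lemma cblock_sum (I : finType) (f : I -> C) :
  cblock (\sum_i f i) = \sum_i cblock (f i).
Proof. exact: (big_morph _ cblockD cblock0). Qed.

(** Commuting with one nonreal number is commuting with multiplication by i, which is
    complex linearity. *)
Lemma cblock_commute (z : C) (A : 'M[R]_2) : complex.Im z != 0 ->
  cblock z *m A = A *m cblock z -> exists w, A = cblock w.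
Proof.
case: z => p q /= q0 /matrixP e; exists (Complex (A 0 0) (A 1 0)); apply: mx2P.
have := e 0 0; have := e 0 1.
rewrite !mxE !big_ord_recl !big_ord0 !mxE /= (_ : lift 0 0 = 1) => [e1 e0|];
  last exact: val_inj.
split=> //.
  by apply: (mulfI q0); lra.
by apply: (mulfI q0); lra.
Qed.

Variable m : nat.
Implicit Types Z W : 'M[C]_m.

Lemma realifyE Z : realify Z = \mxblock_(a < m, b < m) cblock (Z a b).
Proof. by []. Qed.

Lemma realifyM Z W : realify (Z *m W) = realify Z *m realify W.
Proof.
rewrite !realifyE mul_mxblock; apply: eq_mxblock => i j.
by rewrite mxE cblock_sum; apply: eq_bigr => l _; rewrite cblockM.
Qed.

Lemma realify_inj : injective (@realify R m).
Proof.
move=> Z W; rewrite !realifyE => /eq_mxblockP e.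
by apply/matrixP => i j; apply: cblock_inj.
Qed.

Lemma tr_realify Z : (realify Z)^T = realify (Z ^t* ).
Proof.
rewrite !realifyE tr_mxblock; apply: eq_mxblock => i j.
by rewrite tr_cblock !mxE.
Qed.

Lemma realify_diag (d : 'I_m -> C) :
  realify (diag_mx (\row_i d i)) = \mxdiag_(i < m) cblock (d i).
Proof.
rewrite realifyE /mxdiag; apply: eq_mxblock => i j; rewrite !mxE.
case: eqVneq => [e|_]; last by rewrite mulr0n cblock0.
by case: _ / e; rewrite conform_mx_id mulr1n.
Qed.

Lemma realify_scalar (c : C) : realify (c%:M : 'M[C]_m) = \mxdiag_(i < m) cblock c.
Proof.
rewrite -(realify_diag (fun=> c)) -diag_const_mx; congr (realify (diag_mx _)).
by apply/rowP => i; rewrite !mxE.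
Qed.

Lemma realify1 : realify (1%:M : 'M[C]_m) = 1%:M.
Proof. by rewrite realify_scalar cblock1 mxdiagZ. Qed.

Lemma On_realify Z : On R _ (realify Z) <-> Z \is unitarymx.
Proof.
rewrite /On /= tr_realify -realifyM -realify1; split=> [/realify_inj e|/unitarymxP -> //].
exact/unitarymxP.
Qed.

Lemma realify_commute (z : C) (X : 'M[R]_(dbl m)) : complex.Im z != 0 ->
  realify z%:M *m X = X *m realify z%:M -> exists Z : 'M[C]_m, X = realify Z.
Proof.
move=> z0; rewrite realify_scalar -(submxblockK X) mul_mxdiag_mxblock mul_mxblock_mxdiag.
move=> /eq_mxblockP e.
have /choice [f fE] : forall ij : 'I_m * 'I_m, exists w, submxblock X ij.1 ij.2 = cblock w.
  by move=> [i j]; apply: cblock_commute z0 _; exact: e.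
exists (\matrix_(i, j) f (i, j)); rewrite realifyE; apply: eq_mxblock => i j.
by rewrite mxE; exact: (fE (i, j)).
Qed.

End Realify.

(** * Real Jordan forms and their square roots *)

(** The diagonal form of an involution with [u] positive eigenvalues. *)
Definition sgn_mx (F : nzRingType) n u : 'M[F]_n :=
  diag_mx (\row_(i < n) if (i < u)%N then 1 else - 1).
Arguments sgn_mx F n u : clear implicits.

Lemma prod_if_lt (F : comNzRingType) (n u : nat) (a b : F) : (u <= n)%N ->
  \prod_(i < n) (if (i < u)%N then a else b) = a ^+ u * b ^+ (n - u).
Proof.
move=> un; rewrite -(big_mkord xpredT (fun i => if (i < u)%N then a else b)).
rewrite (big_cat_nat (leq0n u) un) /=.
congr (_ * _).
  rewrite (eq_big_nat _ _ (F2 := fun=> a)); last by move=> i /andP[_ ->].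
  by rewrite prodr_const_nat subn0.
rewrite (eq_big_nat _ _ (F2 := fun=> b)) => [|i /andP[ui _]]; last by rewrite ltnNge ui.
by rewrite prodr_const_nat.
Qed.

Lemma sgn_mxK (F : nzRingType) n u : sgn_mx F n u *m sgn_mx F n u = 1%:M.
Proof.
rewrite /sgn_mx mulmx_diag -diag_const_mx; congr diag_mx; apply/rowP => i.
by rewrite !mxE; case: ifP; rewrite ?mulr1 ?mulrNN ?mulr1.
Qed.

Lemma char_poly_sgn_mx (F : comNzRingType) n u : (u <= n)%N ->
  char_poly (sgn_mx F n u) = ('X - 1) ^+ u * ('X + 1) ^+ (n - u).
Proof.
move=> un; rewrite char_poly_diag -prod_if_lt //; apply: eq_bigr => i _.
by rewrite mxE; case: ifP => _; rewrite ?polyC1 // polyCN polyC1 opprK.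
Qed.

Lemma det_mx22 (F : comNzRingType) (M : 'M[F]_2) :
  \det M = M 0 0 * M 1 1 - M 0 1 * M 1 0.
Proof.
rewrite (expand_det_row M 0) !big_ord_recl big_ord0 addr0 /cofactor !det_mx11 !mxE.
rewrite (_ : lift 0 0 = 1 :> 'I_2); last exact: val_inj.
rewrite (_ : lift 1 0 = 0 :> 'I_2); last exact: val_inj.
by rewrite !expr0 !mul1r /= expr1 mulN1r mulrN.
Qed.

Section Angles.
Variable R : realType.

Lemma cexpiD (a b : R) : cexpi (a + b) = cexpi a * cexpi b.
Proof. by rewrite /cexpi cosD sinD; congr Complex; rewrite /= ; ring. Qed.

Lemma cexpi_pi : cexpi pi = -1 :> R[i].
Proof. by rewrite /cexpi cospi sinpi; apply/eqP; rewrite eq_complex /= oppr0 !eqxx. Qed.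

Lemma cexpi_pihalf : cexpi (pi / 2) = 'i%C :> R[i].
Proof. by rewrite /cexpi cos_pihalf sin_pihalf. Qed.

Lemma cexpiN (t : R) : cexpi (- t) = Num.conj (cexpi t).
Proof. by rewrite /cexpi cosN sinN. Qed.

Lemma cexpi_half_sq (t : R) : cexpi (t / 2) * cexpi (t / 2) = cexpi t.
Proof. by rewrite -cexpiD -splitr. Qed.

Lemma cexpi_subpi (t : R) : cexpi (t - pi) = - cexpi t.
Proof.
by rewrite cexpiD cexpiN cexpi_pi rmorphN rmorph1 mulrN1.
Qed.

Lemma cexpi_norm (t : R) : cexpi t * Num.conj (cexpi t) = 1.
Proof. by rewrite -cexpiN -cexpiD subrr /cexpi cos0 sin0. Qed.

Lemma rotE (t : R) : Defs.rot t = cblock (cexpi t).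
Proof. by []. Qed.

Lemma char_poly_rot (t : R) :
  char_poly (map_mx (real_complex R) (Defs.rot t)) = conj_pair t.
Proof.
rewrite /char_poly det_mx22 !mxE /= /conj_pair cexpiN.
set c := real_complex R (cos t); set s := real_complex R (sin t).
have -> : Num.conj (cexpi t) = c - 'i%C * s by rewrite [LHS]complexE /= rmorphN mulrN.
have -> : cexpi t = c + 'i%C * s by rewrite [LHS]complexE.
rewrite !(rmorphN, rmorphD, rmorphM) /= -/c -/s.
have i2 : ('i%C : R[i])%:P * ('i%C)%:P = -1.
  by rewrite -rmorphM -expr2 sqr_i rmorphN rmorph1.
transitivity (('X - c%:P) * ('X - c%:P) - ('i%C : R[i])%:P * ('i%C)%:P * (s%:P * s%:P)).
  by rewrite i2; ring.
by ring.
Qed.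

Lemma conj_pair_pihalf : conj_pair (pi / 2 : R) = ('X - ('i%C)%:P) * ('X + ('i%C)%:P).
Proof.
rewrite /conj_pair cexpiN cexpi_pihalf; congr (_ * _).
have -> : Num.conj ('i%C : R[i]) = - 'i%C.
  by apply/eqP; rewrite eq_complex /= oppr0 !eqxx.
by rewrite rmorphN opprK.
Qed.

End Angles.

Section RealJordanForms.
Variables (R : realType) (h r k : nat) (m : 'I_r -> nat) (theta : 'I_r -> R).
Variables (u : nat) (mu : 'I_r -> nat).
Hypotheses (hu : (u <= h)%N) (hmu : forall j, (mu j <= m j)%N).

Let J := RJS h m k theta.
Let Jt := RJSt h m k theta u mu.

Lemma RJSE : J = dsum3 1%:M
  (\mxdiag_(j < r) realify ((cexpi (theta j))%:M : 'M[R[i]]_(m j))) (- 1%:M).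
Proof.
apply: dsum3_congr => //; apply: eq_mxdiag => j.
by rewrite realify_scalar.
Qed.

Lemma RJStE : Jt = dsum3 (sgn_mx R h u)
  (\mxdiag_(j < r) realify (cexpi (theta j / 2) *: sgn_mx R[i] (m j) (mu j)))
  (realify (('i%C)%:M : 'M[R[i]]_k)).
Proof.
apply: dsum3_congr => //.
  apply: eq_mxdiag => j; rewrite /sgn_mx -linearZ /=.
  pose d (a : 'I_(m j)) : R[i] :=
    if (a < mu j)%N then cexpi (theta j / 2) else - cexpi (theta j / 2).
  rewrite (_ : _ *: _ = \row_a d a); last first.
    by apply/rowP => a; rewrite !mxE /d; case: ifP; rewrite ?mulr1 ?mulrN1.
  rewrite realify_diag; apply: eq_mxdiag => a.
  by rewrite rotE /d; case: ifP => // _; rewrite cexpi_subpi.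
by rewrite realify_scalar; apply: eq_mxdiag => a; rewrite rotE cexpi_pihalf.
Qed.

Lemma RJSt_sq : Jt *m Jt = J.
Proof.
rewrite RJStE RJSE mulmx_dsum3 sgn_mxK mulmx_mxdiag -realifyM.
apply: dsum3_congr => //.
  apply: eq_mxdiag => j; rewrite -realifyM -scalemxAl -scalemxAr sgn_mxK scalerA.
  by rewrite cexpi_half_sq scalemx1.
rewrite -scalar_mxM -expr2 sqr_i.
rewrite realify_scalar (_ : cblock (-1) = (-1)%:M); last first.
  by apply: mx2P; rewrite !mxE /= !oppr0 mulr0n.
by rewrite mxdiagZ raddfN.
Qed.

Lemma unitary_scalar n (c : R[i]) (Z : 'M[R[i]]_n) : c * Num.conj c = 1 ->
  (c *: Z \is unitarymx) = (Z \is unitarymx).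
Proof.
move=> c1; apply/unitarymxP/unitarymxP;
  by rewrite linearZ /= map_mxZ -scalemxAl -scalemxAr scalerA c1 scale1r.
Qed.

Lemma sgn_mx_herm n p : (sgn_mx R[i] n p)^t* = sgn_mx R[i] n p.
Proof.
rewrite /sgn_mx tr_diag_mx map_diag_mx; congr diag_mx; apply/rowP => i.
by rewrite !mxE; case: ifP; rewrite ?rmorphN rmorph1.
Qed.

Lemma sgn_mx_unitary n p : sgn_mx R[i] n p \is unitarymx.
Proof. by apply/unitarymxP; rewrite sgn_mx_herm sgn_mxK. Qed.

Lemma sgn_mx_tr n p : (sgn_mx R n p)^T = sgn_mx R n p.
Proof. exact: tr_diag_mx. Qed.

Lemma On_RJSt : On R _ Jt.
Proof.
rewrite RJStE; apply/On_dsum3; split.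
- by rewrite /On /= sgn_mx_tr sgn_mxK.
- apply/On_mxdiag => j; apply/On_realify.
  by rewrite unitary_scalar ?cexpi_norm // sgn_mx_unitary.
- apply/On_realify; rewrite -scalemx1 unitary_scalar.
    by apply/unitarymxP; rewrite trmx1 map_mx1 mulmx1.
  by rewrite -cexpi_pihalf cexpi_norm.
Qed.

Lemma char_poly_RJSt : char_poly (map_mx (real_complex R) Jt) =
  ('X - 1) ^+ u * ('X + 1) ^+ (h - u) *
  (\prod_(j < r) (conj_pair (theta j / 2) ^+ mu j *
                  conj_pair (theta j / 2 - pi) ^+ (m j - mu j))) *
  (('X - ('i%C)%:P) * ('X + ('i%C)%:P)) ^+ k.
Proof.
rewrite -map_char_poly /Jt /RJSt char_poly_dsum3 !rmorphM /=.
congr (_ * _ * _).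
- rewrite -/(sgn_mx R h u) char_poly_sgn_mx // !rmorphM !rmorphXn /=.
  by rewrite rmorphB rmorphD /= map_polyX rmorph1.
- rewrite char_poly_mxdiag rmorph_prod; apply: eq_bigr => j _.
  rewrite char_poly_mxdiag rmorph_prod -prod_if_lt //; apply: eq_bigr => a _.
  by rewrite /= map_char_poly char_poly_rot; case: ifP.
- rewrite char_poly_mxdiag rmorph_prod -conj_pair_pihalf.
  rewrite (eq_bigr (fun=> conj_pair (pi / 2 : R))) ?prodr_const ?card_ord // => a _.
  by rewrite /= map_char_poly char_poly_rot.
Qed.

(** Equal characteristic polynomials make every [Y] in the set orthogonally similar to the
    model [Jt]; as both square to [J] up to the fixed change of basis, the similarity
    commutes with [J]. *)
Lemma OSRu_orbit (C0 M : 'M[R]_(rjs_order h m k)) : On R _ C0 -> M = C0 *m J *m C0^T ->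
  OSRu h m k theta u mu M = orbit_map Jt C0 @` comm_On J.
Proof.
move=> oC ME; apply/seteqP; split=> [Y [[oY YY]]|_ [X GX <-]].
  rewrite -char_poly_RJSt => /esym cY.
  have [X0 oX0 X0E] := orthogonal_similar_char_poly On_RJSt oY cY.
  exists (C0^T *m X0).
    apply/comm_OnP; split; first by apply: OnM => //; exact: OnT.
    have MX : M *m X0 = X0 *m J by rewrite -YY -RJSt_sq -mulmxA -X0E mulmxA -X0E mulmxA.
    by rewrite -[RHS]mulmxA -MX ME !mulmxA On_trmulmx // mul1mx.
  rewrite /orbit_map trmx_mul trmxK !mulmxA [C0 *m C0^T]oC mul1mx.
  by rewrite X0E -[Y *m X0 *m X0^T]mulmxA [X0 *m _]oX0 mulmx1 mulOnKT.
have GX' : comm_On (Jt *m Jt) X by rewrite RJSt_sq.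
have [oX _] := (comm_OnP _ _).1 GX.
split; first split.
- exact: (On_orbit_map On_RJSt oC GX').
- by rewrite (orbit_square oC GX') RJSt_sq.
rewrite -char_poly_RJSt; apply/esym.
apply: (@char_poly_similar _ _ _ _ (map_mx (real_complex R) (C0 *m X))).
  by rewrite map_unitmx On_unit //; apply: OnM.
rewrite -!map_mxM; congr map_mx.
by rewrite /orbit_map !mulmxA mulOnTK // mulOnTK.
Qed.

End RealJordanForms.

(** * Commutants of block-scalar matrices *)

Section BlockCommutant.
Variable F : fieldType.

Lemma scalemx_neq_eq0 n p (a b : F) (Y : 'M[F]_(n, p)) : a != b -> a *: Y = b *: Y -> Y = 0.
Proof.
move=> ab /eqP; rewrite -subr_eq0 -scalerBl scaler_eq0 subr_eq0 (negbTE ab).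
by move=> /eqP.
Qed.

Lemma mulmx_mxdiag_scalar_eq0 n r (p_ : 'I_r -> nat) (c : 'I_r -> F) (a : F)
    (X : 'M[F]_(n, \sum_j p_ j)) : (forall j, c j != a) ->
  X *m \mxdiag_(j < r) (c j)%:M = a *: X -> X = 0.
Proof.
move=> ca; rewrite -(submxrowK X) mul_mxrow_mxdiag -mul_scalar_mx mul_mxrow.
move=> /eq_mxrowP e; rewrite -[RHS]mxrow0; apply: eq_mxrow => j.
apply: (scalemx_neq_eq0 (ca j)); have := e j.
by rewrite mul_mx_scalar mul_scalar_mx.
Qed.

Lemma mxdiag_scalar_mulmx_eq0 n r (p_ : 'I_r -> nat) (c : 'I_r -> F) (a : F)
    (X : 'M[F]_(\sum_j p_ j, n)) : (forall j, c j != a) ->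
  \mxdiag_(j < r) (c j)%:M *m X = a *: X -> X = 0.
Proof.
move=> ca /(congr1 trmx); rewrite trmx_mul tr_mxdiag linearZ /= => e.
apply: trmx_inj; rewrite trmx0; apply: (mulmx_mxdiag_scalar_eq0 ca).
by rewrite -e; congr (_ *m _); apply: eq_mxdiag => j; rewrite tr_scalar_mx.
Qed.

(** The block (i, j) of a commuting matrix is killed by [c i - c j]. *)
Lemma mxdiag_scalar_commutant r (p_ : 'I_r -> nat) (c : 'I_r -> F)
    (X : 'M[F]_(\sum_j p_ j)) : injective c ->
  \mxdiag_(j < r) (c j)%:M *m X = X *m \mxdiag_(j < r) (c j)%:M ->
  X = \mxdiag_j submxblock X j j.
Proof.
move=> ci; rewrite -{1 2}(submxblockK X) mul_mxdiag_mxblock mul_mxblock_mxdiag.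
move=> /eq_mxblockP e; rewrite -{1}(submxblockK X) /mxdiag; apply: eq_mxblock => i j.
case: eqVneq => [ij|ij]; first by case: _ / ij; rewrite conform_mx_id.
have := e i j; rewrite mul_mx_scalar mul_scalar_mx; apply: scalemx_neq_eq0.
by apply: contra ij => /eqP /ci ->.
Qed.
End BlockCommutant.

Lemma dsum3_scalar_commutant (R : realType) p r (p_ : 'I_r -> nat) s
    (a b : R) (c : 'I_r -> R) (X : 'M[R]_(p + \sum_j p_ j + s)) :
  a != b -> (forall j, c j != a) -> (forall j, c j != b) -> injective c ->
  let D := dsum3 a%:M (\mxdiag_(j < r) (c j)%:M) b%:M in
  D *m X = X *m D ->
  exists XA XB XC, X = dsum3 XA (\mxdiag_j XB j) XC.
Proof.
move=> ab ca cb ci D.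
rewrite -[X]submxK -[ulsubmx X]submxK -[ursubmx X]vsubmxK -[dlsubmx X]hsubmxK.
set X11 := ulsubmx (ulsubmx X); set X12 := ursubmx (ulsubmx X).
set X21 := dlsubmx (ulsubmx X); set X22 := drsubmx (ulsubmx X).
set X13 := usubmx (ursubmx X); set X23 := dsubmx (ursubmx X).
set X31 := lsubmx (dlsubmx X); set X32 := rsubmx (dlsubmx X).
rewrite /D /dsum3 !mulmx_block !(mul0mx, mulmx0, addr0, add0r).
rewrite mul_block_col mul_row_block !(mul0mx, mulmx0, addr0, add0r).
rewrite !mul_scalar_mx !mul_mx_scalar.
move=> /eq_block_mx [/eq_block_mx [_ e12 e21 e22]].
rewrite scale_col_mx scale_row_mx => /eq_col_mx [e13 e23] /eq_row_mx [e31 e32] _.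
have X12E : X12 = 0 by apply: (mulmx_mxdiag_scalar_eq0 ca); rewrite e12.
have X21E : X21 = 0 by apply: (mxdiag_scalar_mulmx_eq0 ca); rewrite e21.
have X13E : X13 = 0 by apply: scalemx_neq_eq0 ab _.
have X23E : X23 = 0 by apply: (mxdiag_scalar_mulmx_eq0 cb).
have X31E : X31 = 0 by apply: (scalemx_neq_eq0 ab); rewrite e31.
have X32E : X32 = 0 by apply: (mulmx_mxdiag_scalar_eq0 cb); rewrite -e32.
exists X11, (fun j => submxblock X22 j j), (drsubmx X).
rewrite X12E X21E X13E X23E X31E X32E col_mx0 row_mx0.
by rewrite {1}(mxdiag_scalar_commutant ci e22).
Qed.

(** * Involutions and complex structures among orthogonal matrices *)

Lemma inertia_of_char_poly (F : numFieldType) n u (A : 'M[F]_n) :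
  char_poly A = ('X - 1) ^+ u * ('X + 1) ^+ (n - u) -> inertia A u (n - u).
Proof.
move=> cA; exists (nseq u 1 ++ nseq (n - u) (- 1)); split.
- rewrite cA big_cat !big_nseq /= !iter_mulr_1.
  by rewrite polyCN polyC1 opprK.
- by rewrite count_cat !count_nseq ltr01 oppr_gt0 ltr10 mul1n mul0n addn0.
- by rewrite count_cat !count_nseq ltr10 oppr_lt0 ltr01 mul1n mul0n.
Qed.

(** The eigenvalues of an involution are 1 and -1, so that the inertia counts them. *)
Lemma char_poly_involution (F : numFieldType) n (A : 'M[F]_n) p q :
  A *m A = 1%:M -> inertia A p q -> char_poly A = ('X - 1) ^+ p * ('X + 1) ^+ q.
Proof.
move=> AA [s [cA <- <-]].
have s1 x : x \in s -> (x == 1) || (x == -1).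
  move=> xs; have : root (char_poly A) x by rewrite cA root_prod_XsubC.
  rewrite -eigenvalue_root_char => /eigenvalueP [v vA v0].
  rewrite -sqrf_eq1; apply/eqP.
  have : x ^+ 2 *: v = 1 *: v.
    by rewrite scale1r expr2 -scalerA -vA scalemxAl -vA -mulmxA AA mulmx1.
  by move/eqP; rewrite -subr_eq0 -scalerBl scaler_eq0 (negbTE v0) orbF subr_eq0 => /eqP.
rewrite cA {cA}; elim: s s1 => [|x s IH] s1; first by rewrite big_nil mulr1.
rewrite big_cons IH; last by move=> y ys; apply: s1; rewrite inE ys orbT.
have /orP[/eqP ->|/eqP ->] := s1 x (mem_head _ _) => /=.
  by rewrite ltr01 ltr10 exprS mulrA polyC1.
by rewrite oppr_gt0 oppr_lt0 ltr10 ltr01 polyCN polyC1 opprK exprS mulrCA.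
Qed.

(** The eigenvalues are i and -i, and the trace, being zero, forces equal multiplicities. *)
Lemma char_poly_skew_orthogonal (R : realType) k (A : 'M[R]_(dbl k)) :
  On R _ A -> so R _ A ->
  char_poly (map_mx (real_complex R) A) =
    (('X - ('i%C)%:P) * ('X + ('i%C)%:P)) ^+ k.
Proof.
move=> oA sA; pose toC := real_complex R; set B := map_mx toC A.
have BB : B *m B = (-1)%:M.
  rewrite -map_mxM; have -> : A *m A = - 1%:M.
    by rewrite -[A in X in A *m X]opprK -[- A]sA mulmxN [A *m _]oA.
  by rewrite map_mxN map_mx1 raddfN.
have trB : \tr B = 0.
  have : \tr A = 0.
    have := mxtrace_tr A; rewrite [A^T]sA raddfN /= => /eqP; rewrite eqNr => /eqP //.
  by rewrite /B trace_map_mx => ->; rewrite rmorph0.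
have Bn : B \is normalmx.
  have BT : B^t* = - B.
    rewrite -map_mxN -[- A]sA; apply/matrixP => i j; rewrite !mxE.
    exact: conjc_real.
  by apply/normalmxP; rewrite BT mulmxN mulNmx.
have /orthomx_spectralP := Bn.
set U := spectralmx B; set d := spectral_diag B => BE.
have UU : U \in unitmx := spectral_unit B.
have UB : U *m B = diag_mx d *m U by rewrite {1}BE !mulmxA mulmxV // mul1mx.
have cB : char_poly B = \prod_i ('X - (d 0 i)%:P).
  by rewrite (char_poly_similar UU UB) char_poly_diag.
have d2 i : d 0 i = 'i%C \/ d 0 i = - 'i%C.
  have DD : diag_mx d *m diag_mx d = (-1)%:M.
    apply: (can_inj (mulmxK UU)); rewrite -mulmxA -UB mulmxA -UB -mulmxA BB.
    by rewrite scalar_mxC.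
  have /matrixP /(_ i i) := DD.
  rewrite mulmx_diag !mxE eqxx !mulr1n -expr2 -sqr_i => /eqP.
  by rewrite eqf_sqr => /orP[] /eqP ->; [left|right].
pose a := #|[pred i | d 0 i == 'i%C]|; pose b := #|[predC [pred i | d 0 i == 'i%C]]|.
have ab : (a + b = dbl k)%N by rewrite cardC card_ord.
(* The trace of the diagonal form, that is of the skew matrix itself. *)
have trd : ('i%C : R[i]) *+ a - 'i%C *+ b = 0.
  rewrite -trB -[B](mulKmx UU) mxtrace_mulC UB mulmxK // mxtrace_diag.
  rewrite (bigID [pred i | d 0 i == 'i%C]) /=; congr (_ + _).
    rewrite (eq_bigr (fun=> 'i%C)) ?sumr_const // => i /eqP //.
  rewrite (eq_bigr (fun=> - 'i%C)) ?sumr_const ?mulNrn // => i.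
  by have [->|->] := d2 i; rewrite ?eqxx.
have ab' : a = b.
  apply/eqP; rewrite -(eqr_nat R[i]) -subr_eq0.
  have i0 : ('i%C : R[i]) != 0.
    by rewrite eq_complex /= oner_eq0 andbF.
  by rewrite -(mulrI_eq0 _ (mulfI i0)) mulrBr !mulr_natr trd.
have ak : a = k.
  have : (a + b = k + k)%N by rewrite ab /dbl sum_nat_const card_ord muln2 addnn.
  by rewrite -ab' !addnn => /double_inj.
rewrite cB (bigID [pred i | d 0 i == 'i%C]) /= exprMn; congr (_ * _).
  rewrite (eq_bigr (fun=> 'X - ('i%C)%:P)) ?prodr_const -?/a ?ak // => i /eqP -> //.
rewrite (eq_bigr (fun=> 'X + ('i%C)%:P)) ?prodr_const -?/b -?ab' ?ak // => i.
by have [->|->] := d2 i; rewrite ?eqxx // polyCN opprK.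
Qed.

Lemma tr_realify_i (R : realType) k :
  (realify (('i%C)%:M : 'M[R[i]]_k))^T = - realify (('i%C)%:M : 'M[R[i]]_k).
Proof.
rewrite realify_scalar tr_mxdiag -mxdiagN; apply: eq_mxdiag => a.
by apply: mx2P; rewrite !mxE /= !oppr0 opprK.
Qed.

Lemma On_realify_i (R : realType) k : On R (dbl k) (realify ('i%C)%:M).
Proof.
apply/On_realify; rewrite -scalemx1 unitary_scalar.
  by apply/unitarymxP; rewrite trmx1 map_mx1 mulmx1.
by rewrite -cexpi_pihalf cexpi_norm.
Qed.

Lemma On_sgn_mx (R : realType) n u : On R n (sgn_mx R n u).
Proof. by rewrite /On /= sgn_mx_tr sgn_mxK. Qed.

Lemma symmetric_orthogonal_conj (R : realType) n u (A : 'M[R]_n) : (u <= n)%N ->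
  On R n A -> GLSym R n u A -> exists2 X, On R n X & X *m sgn_mx R n u *m X^T = A.
Proof.
move=> un oA [_ sA iA].
have AA : A *m A = 1%:M by rewrite -{2}sA.
have cA := char_poly_involution AA iA.
have [X oX XA] : exists2 X, On R n X & X *m sgn_mx R n u = A *m X.
  apply: orthogonal_similar_char_poly => //; first exact: On_sgn_mx.
  by rewrite -!map_char_poly cA char_poly_sgn_mx.
by exists X => //; rewrite XA mulOnKT.
Qed.

Lemma hermitian_unitary_conj (R : realType) n u (Z : 'M[R[i]]_n) : (u <= n)%N ->
  Un R n Z -> Herm R n u Z ->
  exists2 V : 'M[R[i]]_n, V \is unitarymx & V *m sgn_mx R[i] n u *m V^t* = Z.
Proof.
move=> un uZ [_ hZ iZ].
have ZZ : Z *m Z = 1%:M.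
  have /is_hermitianmxP := hZ; rewrite expr0 scale1r => e.
  by rewrite {2}e; exact/unitarymxP.
have cZ := char_poly_involution ZZ iZ.
have [V uV VZ] : exists2 V, V \is unitarymx & V *m sgn_mx R[i] n u = Z *m V.
  apply: normal_unitary_similar.
  - by apply/normalmxP; rewrite sgn_mx_herm.
  - exact: hermitian_normalmx.
  - by rewrite cZ char_poly_sgn_mx.
by exists V => //; rewrite VZ -mulmxA (unitarymxP uV) mulmx1.
Qed.

Lemma skew_orthogonal_conj (R : realType) k (A : 'M[R]_(dbl k)) :
  On R _ A -> so R _ A ->
  exists2 X, On R _ X & X *m realify ('i%C)%:M *m X^T = A.
Proof.
move=> oA sA.
have [||X oX XA] := @orthogonal_similar_char_poly R _ (realify ('i%C)%:M) A _ oA.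
- exact: On_realify_i.
- rewrite !char_poly_skew_orthogonal //; first exact: On_realify_i.
  exact: tr_realify_i.
- by exists X => //; rewrite XA mulOnKT.
Qed.

(** * Decomposition of the square roots into direct sums *)

Section DirectSumDecomposition.
Variables (R : realType) (h r k : nat) (m : 'I_r -> nat) (theta : 'I_r -> R).
Hypothesis htheta : forall j, 0 < theta j < pi.
Hypothesis htheta_incr : forall i j : 'I_r, (i < j)%N -> theta i < theta j.
Variables (u : nat) (mu : 'I_r -> nat).
Hypotheses (hu : (u <= h)%N) (hmu : forall j, (mu j <= m j)%N).

Let J := RJS h m k theta.
Let Jt := RJSt h m k theta u mu.

Let theta_itv j : theta j \in `[0, pi].
Proof. by rewrite in_itv /= !ltW //; have /andP[] := htheta j. Qed.

Lemma cos_theta_inj : injective (fun j => 2 * cos (theta j)).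
Proof.
move=> i j /(mulfI _) e.
have {}e : cos (theta i) = cos (theta j) by apply: e; rewrite pnatr_eq0.
have tij : theta i = theta j by apply: cos_inj e.
apply: val_inj; have [ij|ji|//] := ltngtP i j.
  by have := htheta_incr ij; rewrite tij ltxx.
by have := htheta_incr ji; rewrite tij ltxx.
Qed.

Lemma cos_theta_neq (e : R) j : (e == 0) || (e == pi) -> 2 * cos (theta j) != 2 * cos e.
Proof.
move=> e0; apply: contraTneq (htheta j) => /mulfI ce.
have {}ce : cos (theta j) = cos e by apply: ce; rewrite pnatr_eq0.
have eitv : e \in `[0, pi].
  by case/orP: e0 => /eqP ->; rewrite in_itv /= ?lexx pi_ge0.
have -> : theta j = e by apply: cos_inj ce.
by case/orP: e0 => /eqP ->; rewrite ltxx ?andbF.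
Qed.

(** A matrix commuting with an orthogonal one commutes with its sum with its transpose;
    here this sum is block-scalar with distinct scalars, because the cosine is injective on
    [0, pi]. *)
Lemma RJS_add_tr : J + J^T = dsum3 (2 * cos 0)%:M
  (\mxdiag_(j < r) (2 * cos (theta j))%:M) (2 * cos pi)%:M.
Proof.
rewrite /J RJSE tr_dsum3 addmx_dsum3 trmx1 linearN /= trmx1 cos0 cospi.
apply: dsum3_congr.
- by rewrite mulr1 -raddfD.
- rewrite tr_mxdiag -mxdiagD; apply: eq_mxdiag => j.
  rewrite realify_scalar tr_mxdiag -mxdiagD -mxdiagZ; apply: eq_mxdiag => a.
  by apply: mx2P; rewrite !mxE /=; split; ring.
- by rewrite -opprD -raddfD mulrN1 raddfN.
Qed.

(** Distinct eigenvalues split the matrix into blocks, and commuting with a rotation other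
    than 1 and -1 makes the middle blocks complex linear. *)
Lemma comm_On_RJS_block X : comm_On J X ->
  exists XA (V : forall j, 'M[R[i]]_(m j)) XC,
    X = dsum3 XA (\mxdiag_(j < r) realify (V j)) XC /\
    [/\ On R h XA, forall j, V j \is unitarymx & On R _ XC].
Proof.
move=> GX; have /comm_OnP [oX JX] := GX.
have JTX : J^T *m X = X *m J^T.
  have := congr1 trmx ((comm_OnP _ _).1 (comm_OnT GX)).2.
  by rewrite !trmx_mul !trmxK => ->.
have : (J + J^T) *m X = X *m (J + J^T) by rewrite mulmxDl mulmxDr JX JTX.
have ab : 2 * cos 0 != 2 * cos pi :> R.
  by rewrite cos0 cospi mulr1 mulrN1 eq_sym eqNr pnatr_eq0.
have ca j : 2 * cos (theta j) != 2 * cos 0 by apply: cos_theta_neq; rewrite eqxx.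
have cb j : 2 * cos (theta j) != 2 * cos pi by apply: cos_theta_neq; rewrite eqxx orbT.
rewrite RJS_add_tr => /(dsum3_scalar_commutant ab ca cb cos_theta_inj) [XA [XB [XC XE]]].
have XBV j : exists V : 'M[R[i]]_(m j), XB j = realify V.
  apply: (@realify_commute _ _ (cexpi (theta j))).
    by rewrite /= gt_eqF // sin_gt0_pi.
  move: JX; rewrite /J RJSE XE !mulmx_dsum3 => /dsum3_inj [_ + _].
  by rewrite !mulmx_mxdiag => /eq_mxdiagP.
pose V j := projT1 (cid (XBV j)).
have VE j : XB j = realify (V j) := projT2 (cid (XBV j)).
have XE' : X = dsum3 XA (\mxdiag_(j < r) realify (V j)) XC.
  by rewrite XE; apply: dsum3_congr => //; apply: eq_mxdiag.
exists XA, V, XC; split=> //.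
move: oX; rewrite XE' => /On_dsum3 [oA oB oC]; split=> // j.
by apply/On_realify; move: j; apply/On_mxdiag.
Qed.

Lemma orbit_map1_dsum3 XA (V : forall j, 'M[R[i]]_(m j)) XC :
  orbit_map Jt 1%:M (dsum3 XA (\mxdiag_(j < r) realify (V j)) XC) =
  dsum3 (XA *m sgn_mx R h u *m XA^T)
    (\mxdiag_(j < r) realify
       (cexpi (theta j / 2) *: (V j *m sgn_mx R[i] (m j) (mu j) *m (V j)^t* )))
    (XC *m realify ('i%C)%:M *m XC^T).
Proof.
rewrite /orbit_map mul1mx trmx1 mulmx1 /Jt RJStE tr_dsum3 !mulmx_dsum3.
apply: dsum3_congr => //.
rewrite tr_mxdiag !mulmx_mxdiag; apply: eq_mxdiag => j.
by rewrite tr_realify -!realifyM -scalemxAr -scalemxAl.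
Qed.

(** Both sides are the conjugates of [Jt] by direct sums of orthogonal matrices, of unitary
    matrices and of an orthogonal matrix: for the left side this is the structure of the
    centralizer of [J], for the right side the spectral theorem in each block. *)
Lemma OSRu_RJSE : OSRu h m k theta u mu J =
  dsum_sets (On R h `&` GLSym R h u)
            (fun j => rotated_unitary_herm (m j) (mu j) (theta j))
            (On R (dbl k) `&` so R (dbl k)).
Proof.
rewrite (@OSRu_orbit _ _ _ _ _ _ _ _ hu hmu 1%:M); last by rewrite mul1mx trmx1 mulmx1.
  2: exact: On1.
apply/seteqP; split=> [_ [X GX <-]|_ [A [B [D [[oA [uA sA iA]] hB [oD sD] ->]]]]].
  have [XA [V [XC [XE [oA uV oC]]]]] := comm_On_RJS_block GX.
  rewrite XE orbit_map1_dsum3; eexists _, _, _; split; last by [].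
  - have oS : On R h (XA *m sgn_mx R h u *m XA^T).
      apply: OnM; last exact: OnT.
      by apply: OnM => //; rewrite /On /= sgn_mx_tr sgn_mxK.
    split=> //; split; first exact: On_unit.
      by rewrite !trmx_mul trmxK sgn_mx_tr mulmxA.
    apply: inertia_of_char_poly; rewrite -char_poly_sgn_mx //; apply/esym.
    by apply: (char_poly_similar (On_unit oA)); rewrite mulOnTK.
  - move=> j; eexists; last by [].
    have Vu := unitarymx_unit (uV j).
    have uS : V j *m sgn_mx R[i] (m j) (mu j) *m (V j)^t* \is unitarymx.
      by rewrite !mul_unitarymx ?trmxC_unitary ?sgn_mx_unitary.
    split; first exact: uS.
    split; first exact: (unitarymx_unit uS).
      apply/is_hermitianmxP; rewrite expr0 scale1r !trmx_mul !map_mxM trmxCK.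
      by rewrite sgn_mx_herm mulmxA.
    apply: inertia_of_char_poly; rewrite -char_poly_sgn_mx //; apply/esym.
    by apply: (char_poly_similar Vu); rewrite -invmx_unitary // mulmxKV.
  - split; first by apply: OnM; [apply: OnM => //; exact: On_realify_i|apply: OnT].
    by rewrite /so /= !trmx_mul trmxK tr_realify_i mulNmx mulmxN mulmxA.
have [XA oXA XAE] := symmetric_orthogonal_conj hu oA (And3 uA sA iA).
have [XC oXC XCE] := skew_orthogonal_conj oD sD.
have hV j : exists V : 'M[R[i]]_(m j), V \is unitarymx /\
    B j = realify (cexpi (theta j / 2) *: (V *m sgn_mx R[i] (m j) (mu j) *m V^t* )).
  have [Z [uZ hZ] <-] := hB j.
  by have [V uV <-] := hermitian_unitary_conj (hmu j) uZ hZ; exists V.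
pose V j := projT1 (cid (hV j)).
have uV j : V j \is unitarymx := (projT2 (cid (hV j))).1.
have BE j : B j = _ := (projT2 (cid (hV j))).2.
exists (dsum3 XA (\mxdiag_(j < r) realify (V j)) XC); last first.
  rewrite orbit_map1_dsum3 XAE XCE; apply: dsum3_congr => //.
  by apply: eq_mxdiag => j; rewrite BE.
apply/comm_OnP; split.
  by apply/On_dsum3; split=> //; apply/On_mxdiag => j; exact/On_realify.
rewrite /J RJSE !mulmx_dsum3 mul1mx mulmx1 mulNmx mulmxN mul1mx mulmx1.
apply: dsum3_congr => //; rewrite !mulmx_mxdiag; apply: eq_mxdiag => j.
by rewrite -!realifyM scalar_mxC.
Qed.

End DirectSumDecomposition.

Theorem proposition4p2 (R : realType) (h r k : nat) (m : 'I_r -> nat)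
    (theta : 'I_r -> R)
    (hm : forall j, (0 < m j)%N)
    (htheta : forall j, 0 < theta j < pi)
    (htheta_incr : forall i j : 'I_r, (i < j)%N -> theta i < theta j)
    (M : 'M[R]_(rjs_order h m k)) (hM : SOn R _ M)
    (C0 : 'M[R]_(rjs_order h m k)) (hC0 : On R _ C0)
    (hMJ : M = C0 *m RJS h m k theta *m C0^T)
    (u : nat) (hu : (u <= h)%N)
    (mu : 'I_r -> nat) (hmu : forall j, (mu j <= m j)%N) :
  let J := RJS h m k theta in
  let Jt := RJSt h m k theta u mu in
  let G := centralizer J `&` On R (rjs_order h m k) in
  let H := centralizer Jt `&` On R (rjs_order h m k) in
  let S := OSRu h m k theta u mu M in
  [/\ S = [set C0 *m X *m Jt *m X^T *m C0^T | X in G],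
      S = Gamma C0 @` OSRu h m k theta u mu J,
      OSRu h m k theta u mu J =
        dsum_sets (On R h `&` GLSym R h u)
                  (fun j => rotated_unitary_herm (m j) (mu j) (theta j))
                  (On R (dbl k) `&` so R (dbl k)) &
      compact S /\
      exists2 d, submanifold (On R (rjs_order h m k)) S d &
        exists e (A : set (chart (set 'M[R]_(rjs_order h m k)) e)),
          homogeneous_atlas G H A /\
          diffeomorphic S (embedded_atlas S d) (quotient_set G H) A].
Proof.
move=> J Jt G H S.
have SE : S = orbit_map Jt C0 @` comm_On J by exact: OSRu_orbit.
have SJE : OSRu h m k theta u mu J = orbit_map Jt 1%:M @` comm_On J.
  apply: OSRu_orbit => //; first exact: On1.
  by rewrite trmx1 mul1mx mulmx1.
split.
- exact: SE.
- rewrite SE SJE image_comp; apply: eq_imagel => X GX /=.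
  by rewrite /Gamma /orbit_map mul1mx trmx1 mulmx1 !mulmxA.
- exact: OSRu_RJSE.
- have := orbit_homogeneous (On_RJSt h k m theta u mu) hC0.
  by rewrite RJSt_sq -/J -SE.
Qed.
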